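(* Suppose $p\in\mathbb{C}[z,w]$ has no zeros on $\mathbb{T}\times\overline{\mathbb{D}}$ and $\deg p=(n,m)$. Define $\overleftarrow{p}(z,w)=z^nw^m\overline{p(1/\bar z,1/\bar w)}$. Let $n_2$ be the number of zeros of $p(z,0)$ in $\mathbb{D}$ and $n_1=n-n_2$. Then there exist polynomials $A_1,\dots,A_m,B_1,\dots,B_{n_1},C_1,\dots,C_{n_2}\in\mathbb{C}[z,w]$ such that $$|p(z,w)|^2-|\overleftarrow{p}(z,w)|^2=(1-|w|^2)\sum_{j=1}^m|A_j(z,w)|^2+(1-|z|^2)\Big(\sum_{j=1}^{n_1}|B_j(z,w)|^2-\sum_{j=1}^{n_2}|C_j(z,w)|^2\Big)$$ (for all $(z,w)\in\mathbb{C}^2$). The same result holds if, instead of having no zeros on $\mathbb{T}\times\overline{\mathbb{D}}$, $p$ has no zeros in $\mathbb{T}\times\mathbb{D}$ and no factors in common with $\overleftarrow{p}$.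
   Context: $\mathbb{D}=\{|z|<1\}$, $\mathbb{T}=\partial\mathbb{D}$, $\overline{\mathbb{D}}$ is the closed disk. $\deg p=(n,m)$ means that $p$ has degree $n$ in $z$ and degree $m$ in $w$. Zeros of $p(z,0)$ are counted with multiplicity. ''No factors in common'' means no common nonconstant polynomial factor in $\mathbb{C}[z,w]$. *)

(* Defs.v *)
From mathcomp Require Import all_boot all_order all_algebra.
From mathcomp Require Import polyXY.

Set Implicit Arguments.
Unset Strict Implicit.
Unset Printing Implicit Defensive.

Import Order.TTheory GRing.Theory Num.Theory.
Local Open Scope ring_scope.

(* A polynomial p(z, w) is an element of {poly {poly C}}: the outer variable
   is z and the inner one is w, so that p(z, w) is p.[z, w] and p`_i`_j is the
   coefficient of z^i w^j. *)

Definition has_bidegree (C : nzRingType) (p : {poly {poly C}}) (n m : nat) :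
    Prop :=
  size p = n.+1 /\ sizeY p = m.+1.

(* If p has coefficients a_ij, then z^n w^m conj(p(1/conj z, 1/conj w)) is
   the sum of the conj(a_ij) z^(n-i) w^(m-j); see reflectE. *)
Definition reflect_poly (C : numClosedFieldType) (n m : nat)
    (p : {poly {poly C}}) : {poly {poly C}} :=
  \poly_(i < n.+1) \poly_(j < m.+1) (p`_(n - i)`_(m - j))^*.

(* The polynomial p(z, 0) in z. *)
Definition at_w0 (C : nzRingType) (p : {poly {poly C}}) : {poly C} :=
  map_poly (horner_eval 0) p.

(* With multiplicity; meaningful only for q != 0. The list of roots is
   unique up to permutation, see nb_zeros_diskE. *)
Definition nb_zeros_disk (C : numClosedFieldType) (q : {poly C}) : nat :=
  count (fun a => `|a| < 1) (sval (closed_field_poly_normal q)).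

(* This is divisibility in C[z, w]; polydiv's %| on {poly {poly C}} is only
   pseudo-divisibility, i.e. divisibility in C(w)[z]. *)
Definition divides2 (C : nzRingType) (d p : {poly {poly C}}) : Prop :=
  exists q : {poly {poly C}}, p = d * q.

Definition constant2 (C : nzRingType) (d : {poly {poly C}}) : Prop :=
  exists c : C, d = c%:P%:P.

Definition no_common_factor (C : nzRingType) (p q : {poly {poly C}}) : Prop :=
  forall d : {poly {poly C}}, divides2 d p -> divides2 d q -> constant2 d.

Lemma reflectE (C : numClosedFieldType) (n m : nat) (p : {poly {poly C}})
    (z w : C) :
  has_bidegree p n m -> z != 0 -> w != 0 ->
  (reflect_poly n m p).[z, w] =
    z ^+ n * w ^+ m * (p.[(z^*)^-1, (w^*)^-1])^*.
Proof.
case=> szp szYp z0 w0.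
have ->: (reflect_poly n m p).[z, w] =
  \sum_(i < n.+1) \sum_(j < m.+1) (p`_(n - i)`_(m - j))^* * w ^+ j * z ^+ i.
  rewrite /reflect_poly horner_poly horner_sum; apply: eq_bigr => i _.
  by rewrite -rmorphXn hornerM hornerC horner_poly mulr_suml.
have ->: p.[(z^*)^-1, (w^*)^-1] =
  \sum_(i < n.+1) \sum_(j < m.+1)
     p`_i`_j * (w^*)^-1 ^+ j * (z^*)^-1 ^+ i.
  rewrite (@horner_coef_wide _ n.+1 p) ?szp // horner_sum.
  apply: eq_bigr => i _.
  rewrite -rmorphXn hornerM hornerC (@horner_coef_wide _ m.+1 p`_i).
    by rewrite mulr_suml.
  by rewrite -szYp max_size_coefXY.
rewrite rmorph_sum mulr_sumr (reindex_inj rev_ord_inj) /=.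
apply: eq_bigr => i _; rewrite rmorph_sum mulr_sumr.
rewrite (reindex_inj rev_ord_inj) /=; apply: eq_bigr => j _.
have lein : (i <= n)%N := ltn_ord i; have lejm : (j <= m)%N := ltn_ord j.
rewrite !subSS !subKn // !rmorphM /=.
have cE (x : C) k : (x^*^-1 ^+ k)^* = x ^- k.
  by rewrite rmorphXn /= fmorphV /= conjCK exprVn.
rewrite !cE !expfB_cond ?(negPf z0) ?(negPf w0) ?add0n //.
rewrite [RHS]mulrC -!mulrA; congr (_ * _); rewrite mulrCA; congr (_ * _).
by rewrite mulrC -mulrA [RHS]mulrCA.
Qed.

Lemma nb_zeros_diskE (C : numClosedFieldType) (q : {poly C}) (c : C)
    (s : seq C) :
  c != 0 -> q = c *: \prod_(a <- s) ('X - a%:P) ->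
  nb_zeros_disk q = count (fun a => `|a| < 1) s.
Proof.
move=> c0 qE; rewrite /nb_zeros_disk.
case: closed_field_poly_normal => r /= rE.
have lc: lead_coef q = c.
  by rewrite qE lead_coefZ (monicP (monic_prod_XsubC _ _ _)) mulr1.
suff /permP -> : perm_eq r s by [].
apply: prod_XsubC_eq; apply: (scalerI c0).
by rewrite -qE -{1}lc -rE.
Qed.

Lemma nb_zeros_disk_le (C : numClosedFieldType) (p : {poly {poly C}})
    (n m : nat) :
  has_bidegree p n m -> at_w0 p != 0 -> (nb_zeros_disk (at_w0 p) <= n)%N.
Proof.
case=> szp _ q0; rewrite /nb_zeros_disk.
case: closed_field_poly_normal => r /= rE.
apply: (leq_trans (count_size _ _)).
have: (size (at_w0 p) <= n.+1)%N by rewrite -szp size_poly.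
by rewrite rE size_scale ?lead_coef_eq0 // size_prod_XsubC ltnS.
Qed.

(* Main.v *)
Require Import Defs.
From mathcomp Require Import all_boot all_order all_algebra.
From mathcomp Require Import polyXY complex reals.
From mathcomp Require Import spectral sesquilinear ring lra.
From mathcomp Require Import boolp classical_sets filter topology normedtype.
From mathcomp Require Import sequences.

Set Implicit Arguments.
Unset Strict Implicit.
Unset Printing Implicit Defensive.

Import Order.TTheory GRing.Theory Num.Theory.
Local Open Scope ring_scope.
Local Open Scope sesquilinear_scope.



(** The identity is first proved on the circle [|z| = 1], and the defect off
    the circle is then a multiple of [1 - |z|^2] by a Hermitian form whose
    signature is computed.

    Write [q] for the reflection of [p] and suppose that [p] has no zeros on
    the circle times the closed disk. For fixed [z] on the circle, [p(z, .)]
    has no zeros in the closed disk and [q(z, .)] is its reflection up to a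
    unimodular constant, so
    [|p|^2 - |q|^2 = (1 - |w|^2) <T(z) e, e>] with [e = (1, w, ..., w^(m-1))]
    and [T(z)] the Schur-Cohn matrix, which is positive definite
    ([schur_cohn_posdef]). Being a trigonometric polynomial in [z], [T] has a
    factorization [T = A* A] on the circle with [A] a matrix polynomial whose
    determinant has no zeros in the closed disk ([fejer_riesz]). In
    coefficients of powers of [w], the identity on the circle says that the
    square matrices [M], with first row the coefficients of [p] and below it
    [0] followed by [A], and [N], with first row the coefficients of [q] and
    below it [A] followed by [0], satisfy [M* M = N* N] for [|z| = 1].

    Hence [(M(z)* M(z) - N(z)* N(z)) / (1 - |z|^2)] is a polynomial Hermitian
    form in the monomials [z^i w^j] with [i < n] ([hform_powsum]). As a form
    on vectors [C] of polynomials of degree less than [n] it is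
    [|M C|^2 - |N C|^2], where the norm counts only the coefficients of index
    less than [n], and it is nonnegative as soon as the rest of [M C] can be
    divided by [M] without poles in the closed disk ([hform_ge0]). As
    [det M = p(z, 0) det A], this is one condition for each zero of [p(z, 0)]
    in the disk, which bounds the number of negative squares by [n2].
    Exchanging [M] and [N] changes the sign of the form, and [det N] is up to
    sign [det A] times the reflection of [p(z, 0)], with [n - n2] zeros in
    the disk; so there are at most [n1 = n - n2] positive squares. The
    spectral theorem then produces the [B] and the [C].

    If [p] has zeros on the boundary [|w| = 1], the decomposition holds for
    [p(z, r w)] with [r < 1], with the same [n1] and [n2], since [p(z, 0)]
    does not change. The coefficients of [A], [B] and [C] are bounded
    independently of [r] ([strict_decomposition]), so they have limits along
    an ultrafilter as [r] tends to [1]. *)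

(** * Polynomials on the unit circle *)

Section Circle.
Variable F : numClosedFieldType.
Implicit Types (f g : {poly F}) (z w : F).

Lemma conj_circle z : `|z| = 1 -> z^* = z^-1.
Proof. by move=> z1; rewrite invC_norm z1 expr1n invr1 mul1r. Qed.

Lemma circle_neq0 z : `|z| = 1 -> z != 0.
Proof. by move=> z1; rewrite -normr_eq0 z1 oner_eq0. Qed.

Lemma poly_circle_eq0 f : (forall z, `|z| = 1 -> f.[z] = 0) -> f = 0.
Proof.
move=> f0; pose u (k : nat) : F := (k%:R + 'i) / (k%:R - 'i).
have ki0 (k : nat) : k%:R - 'i != 0 :> F.
  apply/eqP => /subr0_eq ki; have : (k ^ 2).+1%:R = 0 :> F.
    by rewrite -natr1 natrX ki sqrCi addNr.
  by move/eqP; rewrite pnatr_eq0.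
have conj_ki (k : nat) : (k%:R - 'i)^* = k%:R + 'i :> F.
  by rewrite rmorphB /= conjCi rmorph_nat opprK.
have u1 k : `|u k| = 1.
  by rewrite normf_div -conj_ki norm_conjC divff ?normr_eq0.
have u_inj : injective u.
  move=> k l /eqP; rewrite eqr_div // => /eqP kl.
  have : (2 * 'i) * (k%:R - l%:R) = 0 :> F.
    have -> : (2 * 'i) * (k%:R - l%:R) =
      (l%:R + 'i) * (k%:R - 'i) - (k%:R + 'i) * (l%:R - 'i) :> F by ring.
    by rewrite kl subrr.
  move=> /eqP; rewrite !mulf_eq0 pnatr_eq0 /= (negPf (neq0Ci F)) /= subr_eq0.
  by rewrite eqr_nat => /eqP.
apply: (@roots_geq_poly_eq0 _ _ [seq u k | k <- iota 0 (size f)]).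
- by apply/allP => _ /mapP [k _ ->]; apply/rootP/f0.
- by rewrite map_inj_uniq ?iota_uniq.
- by rewrite size_map size_iota.
Qed.

Lemma poly_circle_eq f g : (forall z, `|z| = 1 -> f.[z] = g.[z]) -> f = g.
Proof.
move=> fg; apply/eqP; rewrite -subr_eq0; apply/eqP/poly_circle_eq0 => z z1.
by rewrite hornerD hornerN fg ?subrr.
Qed.

Definition crev (n : nat) f : {poly F} := \poly_(k < n.+1) (f`_(n - k))^*.

Lemma size_crev n f : (size (crev n f) <= n.+1)%N.
Proof. exact: size_poly. Qed.

Lemma horner_crev n f z : (size f <= n.+1)%N -> z != 0 ->
  (crev n f).[z] = z ^+ n * (f.[(z^*)^-1])^*.
Proof.
move=> szf z0; rewrite /crev horner_poly (horner_coef_wide _ szf).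
rewrite rmorph_sum /= mulr_sumr (reindex_inj rev_ord_inj) /=.
apply: eq_bigr => k _; have lekn : (k <= n)%N := ltn_ord k.
rewrite subSS subKn // rmorphM /= mulrCA; congr (_ * _).
by rewrite rmorphXn /= fmorphV /= conjCK exprVn expfB_cond ?(negPf z0).
Qed.

Lemma horner_crev_circle n f z : (size f <= n.+1)%N -> `|z| = 1 ->
  (crev n f).[z] = z ^+ n * (f.[z])^*.
Proof.
move=> szf z1; rewrite horner_crev ?circle_neq0 // (conj_circle z1).
by rewrite invrK.
Qed.

(** An identity between sums of products [f conj(g)] on the circle is a
    polynomial identity, because [conj(g)] is [z^-K] times a polynomial. *)
Lemma circle_identity (I J : finType) (K : nat) (f g : I -> {poly F})
    (f' g' : J -> {poly F}) :
  (forall i, (size (g i) <= K.+1)%N) -> (forall i, (size (g' i) <= K.+1)%N) ->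
  (forall z, `|z| = 1 -> \sum_i (f i).[z] * ((g i).[z])^* =
                         \sum_j (f' j).[z] * ((g' j).[z])^*) ->
  \sum_i f i * crev K (g i) = \sum_j f' j * crev K (g' j).
Proof.
move=> sg sg' E; apply: poly_circle_eq => z z1; rewrite !horner_sum.
have aux (L : finType) (h k : L -> {poly F}) :
    (forall i, (size (k i) <= K.+1)%N) ->
  \sum_i (h i * crev K (k i)).[z] = z ^+ K * \sum_i (h i).[z] * ((k i).[z])^*.
  move=> sk; rewrite mulr_sumr; apply: eq_bigr => i _.
  by rewrite hornerM horner_crev_circle // mulrCA.
by rewrite !aux // E.
Qed.

Lemma size_bound (I : finType) (g : I -> {poly F}) :
  exists K, forall i, (size (g i) <= K)%N.
Proof. by exists (\max_i size (g i)) => i; apply: leq_bigmax. Qed.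

(** Analytic continuation of an identity on the circle: [conj(z)] is
    continued as [1 / z]. *)
Lemma circle_continuation (I J : finType) (f g : I -> {poly F})
    (f' g' : J -> {poly F}) :
  (forall z, `|z| = 1 -> \sum_i (f i).[z] * ((g i).[z])^* =
                         \sum_j (f' j).[z] * ((g' j).[z])^*) ->
  forall z, z != 0 -> \sum_i (f i).[z] * ((g i).[(z^*)^-1])^* =
                         \sum_j (f' j).[z] * ((g' j).[(z^*)^-1])^*.
Proof.
move=> E z z0; have [K1 K1P] := size_bound g; have [K2 K2P] := size_bound g'.
pose K := maxn K1 K2.
have sg i : (size (g i) <= K.+1)%N.
  by rewrite (leq_trans (K1P i)) // ltnW // ltnS leq_maxl.
have sg' i : (size (g' i) <= K.+1)%N.
  by rewrite (leq_trans (K2P i)) // ltnW // ltnS leq_maxr.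
have := congr1 (horner^~ z) (circle_identity sg sg' E); rewrite /= !horner_sum.
have aux (L : finType) (h k : L -> {poly F}) :
    (forall i, (size (k i) <= K.+1)%N) ->
  \sum_i (h i * crev K (k i)).[z] =
    z ^+ K * \sum_i (h i).[z] * ((k i).[(z^*)^-1])^*.
  move=> sk; rewrite mulr_sumr; apply: eq_bigr => i _.
  by rewrite hornerM horner_crev // mulrCA.
by rewrite !aux //; apply: mulfI; rewrite expf_neq0.
Qed.

Lemma coef_mul_crev K f g : (f * crev K g)`_K = \sum_(k < K.+1) f`_k * (g`_k)^*.
Proof.
rewrite coefM; apply: eq_bigr => k _; congr (_ * _).
have lekK : (k <= K)%N := ltn_ord k.
by rewrite coef_poly ltnS leq_subr subKn.
Qed.

(** Parseval: on the circle the mean of [|f|^2] is the sum of the squared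
    coefficients. *)
Lemma parseval (I J : finType) (K : nat) (f : I -> {poly F})
    (g : J -> {poly F}) :
  (forall i, (size (f i) <= K)%N) -> (forall i, (size (g i) <= K)%N) ->
  (forall z, `|z| = 1 -> \sum_i `|(f i).[z]| ^+ 2 = \sum_j `|(g j).[z]| ^+ 2) ->
  \sum_i \sum_(k < K) `|(f i)`_k| ^+ 2 = \sum_j \sum_(k < K) `|(g j)`_k| ^+ 2.
Proof.
move=> sf sg E.
have sf' i : (size (f i) <= K.+1)%N by rewrite leqW.
have sg' i : (size (g i) <= K.+1)%N by rewrite leqW.
have E' z : `|z| = 1 -> \sum_i (f i).[z] * ((f i).[z])^* =
                         \sum_j (g j).[z] * ((g j).[z])^*.
  move=> z1; under eq_bigr do rewrite -normCK; rewrite E //.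
  by apply: eq_bigr => j _; rewrite normCK.
have := congr1 (fun h : {poly F} => h`_K) (circle_identity sf' sg' E').
rewrite /= !coef_sum.
have aux (L : finType) (h : L -> {poly F}) : (forall i, (size (h i) <= K)%N) ->
  \sum_i (h i * crev K (h i))`_K = \sum_i \sum_(k < K) `|(h i)`_k| ^+ 2.
  move=> sh; apply: eq_bigr => i _; rewrite coef_mul_crev big_ord_recr /=.
  rewrite (nth_default 0 (sh i)) mul0r addr0.
  by apply: eq_bigr => k _; rewrite normCK.
by rewrite !aux.
Qed.

End Circle.

(** * The Hermitian form of a pair of matrices isometric on the circle *)

Local Notation ev z M := (map_mx (horner_eval z) M).

Lemma scalemx_coef (R : pzRingType) m n (a : R) (A : 'M[R]_(m, n)) i j :
  (a *: A) i j = a * A i j.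
Proof. by rewrite mxE. Qed.

Lemma submx_coef (V : zmodType) m n (A B : 'M[V]_(m, n)) i j :
  (A - B) i j = A i j - B i j.
Proof. by rewrite !mxE. Qed.

Section TruncatedNorm.
Variables (F : numClosedFieldType) (r : nat).
Implicit Types f g : 'cV[{poly F}]_r.

Definition nrm (n : nat) f : F := \sum_i \sum_(k < n) `|(f i 0)`_k| ^+ 2.

Definition tail (n K : nat) f : F :=
  \sum_i \sum_(n <= k < K) `|(f i 0)`_k| ^+ 2.

Lemma tail_ge0 n K f : 0 <= tail n K f.
Proof.
rewrite /nrm /tail; apply: sumr_ge0 => i _; apply: sumr_ge0 => k _.
exact: exprn_ge0.
Qed.

Lemma nrm_split n K f : (n <= K)%N -> nrm K f = nrm n f + tail n K f.
Proof.
move=> nK; rewrite -big_split; apply: eq_bigr => i _ /=.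
rewrite -!(big_mkord xpredT (fun k => `|(f i 0)`_k| ^+ 2)).
by rewrite (@big_cat_nat _ _ _ n).
Qed.

Lemma eq_nrm n f g :
  (forall i k, (k < n)%N -> (f i 0)`_k = (g i 0)`_k) -> nrm n f = nrm n g.
Proof.
move=> fg; apply: eq_bigr => i _; apply: eq_bigr => k _.
by rewrite fg.
Qed.

End TruncatedNorm.

Section Form.
Variable F : numClosedFieldType.

Definition isometric (r s d : nat) (M : 'M[{poly F}]_(r, d))
    (N : 'M[{poly F}]_(s, d)) : Prop :=
  forall z, `|z| = 1 -> forall x : 'cV[F]_d,
    \sum_i `|(ev z M *m x) i 0| ^+ 2 = \sum_i `|(ev z N *m x) i 0| ^+ 2.

Definition size_mx_le (r d n : nat) (M : 'M[{poly F}]_(r, d)) : Prop :=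
  forall i j, (size (M i j) <= n)%N.

Lemma isometric_sym r s d (M : 'M[{poly F}]_(r, d)) (N : 'M[{poly F}]_(s, d)) :
  isometric M N -> isometric N M.
Proof. by move=> iso z z1 x; rewrite iso. Qed.

Definition hform (r s d n : nat) (M : 'M[{poly F}]_(r, d))
    (N : 'M[{poly F}]_(s, d)) (C : 'cV[{poly F}]_d) : F :=
  nrm n (M *m C) - nrm n (N *m C).

(** Parseval for [M C] and [N C]. *)
Lemma isometric_nrm r s d (M : 'M[{poly F}]_(r, d)) (N : 'M[{poly F}]_(s, d))
    (C : 'cV[{poly F}]_d) :
  isometric M N -> exists K0, forall K, (K0 <= K)%N ->
    nrm K (M *m C) = nrm K (N *m C).
Proof.
move=> iso; have [K1 K1P] := size_bound (fun i => (M *m C) i 0).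
have [K2 K2P] := size_bound (fun i => (N *m C) i 0).
exists (maxn K1 K2) => K; rewrite geq_max => /andP [K1K K2K].
rewrite /nrm; apply: (@parseval _ _ _ K (fun i => (M *m C) i 0)
  (fun i => (N *m C) i 0)) => [i|i|z z1]; first exact: leq_trans (K1P i) K1K.
  exact: leq_trans (K2P i) K2K.
have aux t (L : 'M[{poly F}]_(t, d)) i :
    ((L *m C) i 0).[z] = (ev z L *m ev z C) i 0.
  by rewrite -map_mxM [RHS]mxE.
by under eq_bigr do rewrite aux; rewrite iso //; apply: eq_bigr => i _;
   rewrite aux.
Qed.

(** By Parseval the two full norms agree, so the form is also minus the
    difference of the norms beyond the truncation. *)
Lemma hform_tail r s d n (M : 'M[{poly F}]_(r, d)) (N : 'M[{poly F}]_(s, d))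
    (C : 'cV[{poly F}]_d) :
  isometric M N -> exists K0, forall K, (K0 <= K)%N ->
    hform n M N C = tail n K (N *m C) - tail n K (M *m C).
Proof.
move=> iso; have [K0 K0P] := isometric_nrm C iso.
exists (maxn n K0) => K; rewrite geq_max => /andP [nK K0K].
have := K0P K K0K; rewrite !(nrm_split _ nK) /hform => E.
by apply/eqP; rewrite subr_eq addrAC eq_sym subr_eq addrC E addrC.
Qed.

Lemma size_mul_polyC_mx r d n (M : 'M[{poly F}]_(r, d)) (c : 'cV[F]_d) i :
  size_mx_le n M -> (size ((M *m map_mx polyC c) i 0%R) <= n)%N.
Proof.
move=> sM; rewrite mxE; apply: (leq_trans (size_sum _ _ _)).
apply/bigmax_leqP => j _; rewrite mxE mulrC mul_polyC.
exact: leq_trans (size_scale_leq _ _) (sM i j).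
Qed.

(** The form depends only on the coefficients beyond the truncation, which are
    not affected by a constant added after a shift. *)
Lemma hform_shift r s d n (M : 'M[{poly F}]_(r, d)) (N : 'M[{poly F}]_(s, d))
    (C : 'cV[{poly F}]_d) (c : 'cV[F]_d) :
  isometric M N -> size_mx_le n.+1 M -> size_mx_le n.+1 N ->
  hform n.+1 M N ('X *: C + map_mx polyC c) = hform n M N C.
Proof.
move=> iso sM sN; have [K1 K1P] := hform_tail n C iso.
have [K2 K2P] := hform_tail n.+1 ('X *: C + map_mx polyC c) iso.
rewrite (K1P (maxn K1 K2)) ?leq_maxl // (K2P (maxn K1 K2).+1); last first.
  by rewrite leqW // leq_maxr.
have aux t (L : 'M[{poly F}]_(t, d)) (sL : size_mx_le n.+1 L) K :
    tail n.+1 K.+1 (L *m ('X *: C + map_mx polyC c)) = tail n K (L *m C).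
  apply: eq_bigr => i _; rewrite big_add1 /= big_nat [RHS]big_nat.
  apply: eq_bigr => k /andP [nk _]; rewrite mulmxDr mxE -scalemxAr coefD.
  rewrite scalemx_coef coefXM /= [X in _ + X]nth_default ?addr0 //.
  by rewrite (leq_trans (size_mul_polyC_mx c i sL)).
by rewrite !aux.
Qed.

(** [('X^n - z^n) / ('X - z)] *)
Definition powsum (z : F) (n : nat) : {poly F} :=
  \poly_(j < n) z ^+ (n.-1 - j).

Lemma powsumS_scale z n : powsum z n.+1 = z *: powsum z n + 'X^n.
Proof.
apply/polyP => j; rewrite coefD coefZ !coef_poly coefXn ltnS leq_eqVlt.
case: (ltngtP j n) => [jn|nj|->]; rewrite /= ?addr0 ?mulr0 //.
  have n0 := leq_ltn_trans (leq0n j) jn.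
  by rewrite -exprS -subSn ?(prednK n0) // -ltnS (prednK n0).
by rewrite subnn expr0 add0r.
Qed.

Lemma powsumS_shift z n : powsum z n.+1 = 'X * powsum z n + (z ^+ n)%:P.
Proof.
apply/polyP => j; rewrite coefD coefXM coefC !coef_poly ltnS.
case: j => [|j] /=; first by rewrite subn0 add0r.
by rewrite addr0 -[n.-1]subn1 -subnDA add1n.
Qed.

Lemma coef_powsumM z n (g : {poly F}) : (size g <= n.+1)%N ->
  (powsum z n.+1 * g)`_n = g.[z].
Proof.
move=> sg; rewrite (horner_coef_wide _ sg) coefM [RHS](reindex_inj rev_ord_inj).
apply: eq_bigr => k _; rewrite coef_poly ltn_ord mulrC /= subSS //.
Qed.

Lemma nrm_powsum r d n (M : 'M[{poly F}]_(r, d)) (z : F) (e : 'cV[F]_d) :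
  size_mx_le n.+1 M ->
  nrm n.+1 (M *m (powsum z n.+1 *: map_mx polyC e)) =
    `|z| ^+ 2 * nrm n (M *m (powsum z n *: map_mx polyC e))
    + \sum_i `|(ev z M *m e) i 0| ^+ 2.
Proof.
move=> sM; rewrite mulr_sumr -big_split; apply: eq_bigr => i _ /=.
rewrite big_ord_recr /= mulr_sumr; congr (_ + _).
  apply: eq_bigr => k _; rewrite -!scalemxAr scalemx_coef powsumS_scale.
  rewrite mulrDl coefD coefXnM ltn_ord addr0 -scalerAl coefZ normrM exprMn.
  by rewrite scalemx_coef.
rewrite -scalemxAr scalemx_coef coef_powsumM ?size_mul_polyC_mx //.
congr (`|_| ^+ 2); rewrite !mxE horner_sum; apply: eq_bigr => j _.
by rewrite !mxE hornerM hornerC.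
Qed.

(** The two ways to pass from [powsum z n] to [powsum z n.+1], a shift which
    preserves the form and a scaling by [z], compute the form. *)
Lemma hform_powsum r s d n (M : 'M[{poly F}]_(r, d)) (N : 'M[{poly F}]_(s, d))
    (z : F) (e : 'cV[F]_d) :
  isometric M N -> size_mx_le n.+1 M -> size_mx_le n.+1 N ->
  (1 - `|z| ^+ 2) * hform n M N (powsum z n *: map_mx polyC e) =
    \sum_i `|(ev z M *m e) i 0| ^+ 2 - \sum_i `|(ev z N *m e) i 0| ^+ 2.
Proof.
move=> iso sM sN; set C := powsum z n *: map_mx polyC e.
have C'E : powsum z n.+1 *: map_mx polyC e =
    'X *: C + map_mx polyC (z ^+ n *: e).
  rewrite powsumS_shift scalerDl scalerA; congr (_ + _).
  by apply/colP => i; rewrite !mxE polyCM.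
have := hform_shift C (z ^+ n *: e) iso sM sN.
rewrite -C'E /hform !nrm_powsum // -/C => E.
by rewrite mulrBl mul1r -{1}E; ring.
Qed.

End Form.

(** * Positivity of the form off the zeros in the disk *)

Section L1.
Variable F : numClosedFieldType.
Implicit Types p q : {poly F}.

Definition l1 p : F := \sum_(k < size p) `|p`_k|.

Lemma l1_wide n p : (size p <= n)%N -> l1 p = \sum_(k < n) `|p`_k|.
Proof.
move=> pn; rewrite /l1 -!(big_mkord xpredT (fun k => `|p`_k|)).
rewrite [RHS](@big_cat_nat _ _ _ (size p)) //= -[LHS]addr0; congr (_ + _).
rewrite big_nat big1 // => k /andP [pk _].
by rewrite nth_default ?normr0.
Qed.

Lemma l1_ge0 p : 0 <= l1 p.
Proof. by apply: sumr_ge0. Qed.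

Lemma l1D p q : l1 (p + q) <= l1 p + l1 q.
Proof.
pose n := maxn (size p) (size q).
rewrite (@l1_wide n p) ?leq_maxl // (@l1_wide n q) ?leq_maxr //.
rewrite (@l1_wide n (p + q)) ?size_polyD // -big_split; apply: ler_sum => k _.
by rewrite coefD ler_normD.
Qed.

Lemma l1Z c p : l1 (c *: p) = `|c| * l1 p.
Proof.
rewrite (@l1_wide (size p)) ?size_scale_leq // mulr_sumr.
by apply: eq_bigr => k _; rewrite coefZ normrM.
Qed.

Lemma l1MX p : l1 (p * 'X) = l1 p.
Proof.
rewrite (@l1_wide (size p).+1); last first.
  by rewrite (leq_trans (size_polyMleq _ _)) // size_polyX addn2.
rewrite big_ord_recl coefMX normr0 add0r; apply: eq_bigr => k _.
by rewrite coefMX.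
Qed.

Lemma l1MXn p n : l1 (p * 'X^n) = l1 p.
Proof. by elim: n => [|n IH]; rewrite ?mulr1 // exprSr mulrA l1MX. Qed.

Lemma l1M p q : l1 (p * q) <= l1 p * l1 q.
Proof.
elim/poly_ind: p => [|p c IH].
  by rewrite mul0r /l1 size_poly0 !big_ord0 mul0r.
rewrite mulrDl mulrAC mul_polyC; apply: le_trans (l1D _ _) _.
rewrite l1MX l1Z.
have -> : l1 (p * 'X + c%:P) = l1 p + `|c|.
  rewrite (@l1_wide (size p).+1); last by rewrite size_MXaddC; case: ifP.
  rewrite big_ord_recl coefD coefMX coefC /= add0r addrC; congr (_ + _).
  by apply: eq_bigr => k _; rewrite coefD coefMX coefC /= addr0.
by rewrite mulrDl lerD2r.
Qed.

Lemma sum_coef_sqr_le n p : \sum_(k < n) `|p`_k| ^+ 2 <= (l1 p) ^+ 2.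
Proof.
pose m := maxn n (size p).
rewrite (@l1_wide m) ?leq_maxr //.
have : \sum_(k < n) `|p`_k| ^+ 2 <= \sum_(k < m) `|p`_k| ^+ 2.
  rewrite -!(big_mkord xpredT (fun k => `|p`_k| ^+ 2)).
  rewrite [leRHS](@big_cat_nat _ _ _ n) ?leq_maxl //= lerDl.
  by apply: sumr_ge0 => k _; rewrite exprn_ge0.
move/le_trans; apply; elim: (m) => [|l IH]; first by rewrite !big_ord0 expr0n.
rewrite !big_ord_recr /= sqrrD -addrA lerD // lerDr mulrn_wge0 //.
by rewrite mulr_ge0 // sumr_ge0.
Qed.

End L1.

(** What the estimates below use of the complex numbers, beyond their being a
    closed field with a norm: powers of numbers of norm less than 1 tend
    to 0. *)
Lemma complex_archimedean (R : realType) (x : R[i]) :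
  exists n : nat, `|x| < n%:R.
Proof.
have [r rE] : exists r : R, `|x| = r%:C%C.
  by exists (complex.Re `|x|); apply/esym/RRe_real/normr_real.
exists (Num.bound r); rewrite rE -(rmorph_nat (real_complex R)) ltcR.
by apply: archi_boundP; rewrite -lecR -rE normr_ge0.
Qed.

Section DiskInverse.
Variable F : numClosedFieldType.
Hypothesis archF : forall x : F, exists n : nat, `|x| < n%:R.

Lemma expr_small (x e : F) : `|x| < 1 -> 0 < e -> exists n, `|x| ^+ n < e.
Proof.
move=> x1 e0; have [->|x0] := eqVneq x 0.
  by exists 1%N; rewrite normr0 expr1.
have nx0 : 0 < `|x| by rewrite normr_gt0.
pose y := `|x|^-1 - 1; have y0 : 0 < y by rewrite subr_gt0 invf_gt1.
have [N] := archF (e * y)^-1.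
rewrite ger0_norm ?invr_ge0 ?mulr_ge0 ?ltW // => NP; exists N.
have bern n : 1 + n%:R * y <= `|x|^-1 ^+ n.
  elim: n => [|n IH]; first by rewrite mul0r addr0 expr0.
  rewrite exprS; have -> : `|x|^-1 = 1 + y by rewrite addrC subrK.
  apply: le_trans (_ : (1 + y) * (1 + n%:R * y) <= _).
    rewrite -natr1 -subr_ge0.
    have -> : (1 + y) * (1 + n%:R * y) - (1 + (n%:R + 1) * y) = n%:R * y ^+ 2.
      by ring.
    by rewrite mulr_ge0 // exprn_ge0 // ltW.
  rewrite ler_wpM2l //; first by rewrite addr_ge0 // ltW.
  by rewrite [1 + y]addrC subrK.
rewrite -ltf_pV2 ?posrE ?exprn_gt0 // -exprVn.
apply: lt_le_trans (bern _); apply: lt_trans (_ : N%:R * y < _).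
  by rewrite -ltr_pdivrMr // -invfM.
by rewrite ltrDr.
Qed.

(** Truncate the geometric series of [1 / ('X - a)]. *)
Lemma XsubC_disk_inverse (a e : F) : 1 < `|a| -> 0 < e ->
  exists q, l1 (('X - a%:P) * q - 1) < e.
Proof.
move=> a1 e0; have a0 : a != 0 by rewrite -normr_gt0 (lt_trans ltr01).
have [|n nP] := @expr_small a^-1 e _ e0.
  by rewrite normfV invf_lt1 // (lt_trans ltr01).
exists (- a^-1 *: \sum_(k < n) (a^-1 *: 'X) ^+ k).
have -> : ('X - a%:P) * (- a^-1 *: \sum_(k < n) (a^-1 *: 'X) ^+ k) - 1 =
   - a^-1 ^+ n *: (1 * 'X^n).
  have -> : ('X - a%:P) = (- a) *: (1 - a^-1 *: 'X).
    by rewrite scaleNr scalerBr opprB scalerA divff // scale1r alg_polyC.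
  rewrite -scalerAl -scalerAr scalerA mulrNN divff // scale1r.
  have -> (x : {poly F}) : (1 - x) * \sum_(k < n) x ^+ k = 1 - x ^+ n.
    by rewrite -[RHS]opprB subrX1 -mulNr opprB.
  by rewrite exprZn mul1r [LHS]addrAC subrr add0r scaleNr.
rewrite l1Z l1MXn normrN normrX normfV -normfV.
by rewrite /l1 size_poly1 big_ord1 coef1 normr1 mulr1.
Qed.

(** A polynomial without zeros in the closed disk is invertible among
    absolutely summable series, hence almost invertible among polynomials. *)
Lemma disk_inverse (g : {poly F}) (e : F) :
  (forall z, `|z| <= 1 -> g.[z] != 0) -> 0 < e ->
  exists q, l1 (g * q - 1) < e.
Proof.
move=> g0; have [s gE] := closed_field_poly_normal g.
have gn0 : lead_coef g != 0.
  rewrite lead_coef_eq0; apply: contraTneq (g0 0 _) => [->|].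
    by rewrite horner0 eqxx.
  by rewrite normr0.
have : all (fun a => 1 < `|a|) s.
  apply/allP => a sa; rewrite real_ltNge ?normr_real // ?real1 //.
  apply: contraL sa => /g0; rewrite gE hornerZ mulf_eq0 negb_or => /andP [_].
  by rewrite -root_prod_XsubC.
rewrite gE; move: (lead_coef g) gn0 => c c0 {gE g0}.
suff H : all (fun a => 1 < `|a|) s -> forall e', 0 < e' ->
    exists q, l1 (\prod_(a <- s) ('X - a%:P) * q - 1) < e'.
  move=> /H {}H e0; have [q qP] := H e e0; exists (c^-1 *: q).
  by rewrite -scalerAl -scalerAr scalerA divff // scale1r.
elim: s {e} => [|a s IH] /=.
  move=> _ e e0; exists 1.
  by rewrite big_nil mulr1 subrr /l1 size_poly0 big_ord0.
move=> /andP [a1 /IH {}IH] e e0.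
(* chosen so that the error e1^2 + 2 e1 of the product is at most e *)
pose e1 := e / (2 + e); have e20 : 0 < 2 + e by rewrite addr_gt0.
have e10 : 0 < e1 by rewrite divr_gt0.
have [q qP] := IH e1 e10; have [q' q'P] := XsubC_disk_inverse a1 e10.
exists (q' * q); rewrite big_cons mulrACA.
set x := _ * q' in q'P *; set y := _ * q in qP *.
have -> : x * y - 1 = (x - 1) * (y - 1) + ((x - 1) + (y - 1)) by ring.
apply: le_lt_trans (l1D _ _) _.
apply: le_lt_trans (lerD (l1M _ _) (l1D _ _)) _.
have : l1 (x - 1) * l1 (y - 1) + (l1 (x - 1) + l1 (y - 1)) <
   e1 * e1 + (e1 + e1).
  by rewrite ler_ltD ?ltrD // ler_pM ?l1_ge0 // ltW.
move/lt_le_trans; apply; rewrite -subr_ge0.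
have -> : e - (e1 * e1 + (e1 + e1)) =
    e ^+ 3 / (2 + e) ^+ 2 + e ^+ 2 / (2 + e) ^+ 2.
  by rewrite /e1; field; rewrite gt_eqF.
by rewrite addr_ge0 // divr_ge0 // exprn_ge0 // ltW.
Qed.

End DiskInverse.

Section Positivity.
Variable F : numClosedFieldType.
Hypothesis archF : forall x : F, exists n : nat, `|x| < n%:R.

(** If [t] is the part of [M C] beyond the truncation and [M] can be solved
    for [t] without poles in the closed disk, then subtracting ['X^n M^-1 t]
    from [C] removes this part from [M C] without affecting the truncation of
    [N C], and the isometry compares what is left. Here [M^-1 t = y / g], and
    a polynomial [q] close to [1 / g] makes the subtracted term polynomial at
    the price of an arbitrarily small error [h t]. *)
Lemma hform_ge0 r s d n (M : 'M[{poly F}]_(r, d)) (N : 'M[{poly F}]_(s, d))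
    (C y : 'cV[{poly F}]_d) (g : {poly F}) :
  isometric M N -> (forall z, `|z| <= 1 -> g.[z] != 0) ->
  M *m y = g *: map_mx (drop_poly n) (M *m C) -> 0 <= hform n M N C.
Proof.
move=> iso g0; set t := map_mx _ _ => Myt.
rewrite subr_ge0; apply/ler_addgt0Pr => e e0.
pose B := \sum_i (l1 (t i 0)) ^+ 2.
have B0 : 0 <= B by apply: sumr_ge0 => i _; rewrite exprn_ge0 // l1_ge0.
have Be0 : 0 < 1 + B + e by rewrite addr_gt0 // ltr_wpDr.
have [q qP] := disk_inverse archF g0 (divr_gt0 e0 Be0).
set h := g * q - 1 in qP; pose C' := C - 'X^n *: (q *: y).
have MC' : M *m C' = M *m C - 'X^n *: t - 'X^n *: (h *: t).
  rewrite mulmxBr -!scalemxAr Myt [q *: _]scalerA -addrA -opprD -scalerDr.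
  by rewrite -{2}[t]scale1r -scalerDl /h [1 + _]addrC subrK mulrC.
have NC' : nrm n (N *m C') = nrm n (N *m C).
  apply: eq_nrm => i k kn; rewrite mulmxBr -scalemxAr !mxE coefB coefXnM kn.
  by rewrite subr0.
have MC'lo : nrm n (M *m C') = nrm n (M *m C).
  apply: eq_nrm => i k kn; rewrite MC' !mxE !coefB !coefXnM kn.
  by rewrite !subr0.
have MC'hi i k : ((M *m C') i 0)`_(n + k) = - (h * t i 0)`_k.
  rewrite MC' !submx_coef !scalemx_coef !coefB !coefXnM.
  rewrite ltnNge leq_addr /= addKn.
  by rewrite [t i 0]mxE coef_drop_poly [(k + n)%N]addnC subrr add0r.
have [K0 K0P] := isometric_nrm C' iso.
pose K := maxn n K0; have nK : (n <= K)%N by rewrite leq_maxl.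
have := K0P K (leq_maxr _ _).
rewrite (nrm_split (N *m C') nK) (nrm_split (M *m C') nK) NC' MC'lo => E.
apply: le_trans (_ : nrm n (M *m C) + tail n K (M *m C') <= _).
  by rewrite E lerDl tail_ge0.
rewrite lerD2l.
apply: le_trans (_ : (l1 h) ^+ 2 * B <= _); last first.
  have h1 : l1 h <= 1.
    apply/ltW/(lt_le_trans qP); rewrite ler_pdivrMr // mul1r lerDr.
    by rewrite addr_ge0.
  apply: le_trans (_ : l1 h * B <= _).
    by rewrite expr2 -mulrA ler_piMl // mulr_ge0 // l1_ge0.
  apply: le_trans (_ : e / (1 + B + e) * B <= _).
    by rewrite ler_wpM2r // ltW.
  rewrite mulrAC ler_pdivrMr // ler_wpM2l ?(ltW e0) //.
  by rewrite -addrA addrCA lerDl addr_ge0 // ltW.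
rewrite mulr_sumr; apply: ler_sum => i _; rewrite -exprMn.
apply: le_trans (_ : l1 (h * t i 0) ^+ 2 <= _); last first.
  by rewrite ler_pXn2r ?nnegrE ?mulr_ge0 ?l1_ge0 ?l1M.
apply: le_trans (sum_coef_sqr_le (K - n) _).
rewrite -{1}[n]add0n big_addn big_mkord; apply: ler_sum => k _.
by rewrite addnC MC'hi normrN.
Qed.

End Positivity.

(** * Inertia of a Hermitian form *)

Lemma adjmx_mul (F : numClosedFieldType) m n p (A : 'M[F]_(m, n))
  (B : 'M[F]_(n, p)) : (A *m B)^t* = B^t* *m A^t*.
Proof. by rewrite trmx_mul map_mxM. Qed.

Section Inertia.
Variables (F : numClosedFieldType) (D : nat).
Implicit Types (H U : 'M[F]_D) (l : 'I_D -> F).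

Definition qform H (v : 'cV[F]_D) : F := (v^t* *m H *m v) 0 0.

Lemma qformE H v :
  qform H v = \sum_a \sum_b (v a 0)^* * v b 0 * H a b.
Proof.
rewrite /qform -mulmxA mxE; apply: eq_bigr => a _.
rewrite !mxE mulr_sumr; apply: eq_bigr => b _.
by rewrite mulrAC mulrA.
Qed.

(** The eigenvectors of the positive eigenvalues span a space which meets the
    kernel of [P] only at the origin, so there are at most [nu] of them. *)
Lemma card_pos_le nu (P : 'M[F]_(nu, D)) l U :
  U \is unitarymx ->
  (forall v : 'cV_D, P *m v = 0 -> \sum_a l a * `|(U *m v) a 0| ^+ 2 <= 0) ->
  (#|[pred a | (0 < l a)%R]| <= nu)%N.
Proof.
set S := [pred a | 0 < l a] => /unitarymxP UU npos.
rewrite leqNgt; apply/negP => ltS.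
pose E : 'M[F]_(D, #|S|) := \matrix_(a, k) (a == enum_val k)%:R.
have [y y0 /sub_kermxP Py] : exists2 y : 'rV_#|S|,
    y != 0 & (y <= kermx (P *m U^t* *m E)^T)%MS.
  have /rowV0Pn [y ? ?] : kermx (P *m U^t* *m E)^T != 0.
    rewrite kermx_eq0 /row_free neq_ltn; apply/orP; left.
    exact: leq_ltn_trans (rank_leq_col _) ltS.
  by exists y.
have := npos (U^t* *m (E *m y^T)); rewrite !mulmxA UU mul1mx.
have -> : P *m U^t* *m E *m y^T = 0.
  by apply: trmx_inj; rewrite trmx_mul trmxK Py trmx0.
move=> /(_ erefl) le0.
have Ey k : (E *m y^T) (enum_val k) 0 = y 0 k.
  rewrite mxE (bigD1 k) //= !mxE eqxx mul1r big1 ?addr0 // => k' k'k.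
  by rewrite !mxE (inj_eq enum_val_inj) eq_sym (negPf k'k) mul0r.
have Ey0 a : a \notin S -> (E *m y^T) a 0 = 0.
  move=> aS; rewrite mxE big1 // => k _; rewrite mxE.
  case: eqP => [ak|_]; last by rewrite mul0r.
  by rewrite ak enum_valP in aS.
have ge0 a : 0 <= l a * `|(E *m y^T) a 0| ^+ 2.
  case: (boolP (a \in S)) => [la|/Ey0 ->].
    by rewrite mulr_ge0 ?exprn_ge0 // ltW.
  by rewrite normr0 expr0n mulr0.
have sum0 : \sum_a l a * `|(E *m y^T) a 0| ^+ 2 = 0.
  by apply/eqP; rewrite eq_le le0 sumr_ge0.
case/negP: y0; apply/eqP/rowP => k; rewrite mxE -Ey; apply/eqP.
have /eqP := psumr_eq0P (fun a _ => ge0 a) sum0 (i := enum_val k) isT.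
rewrite mulf_eq0 expf_eq0 normr_eq0 /=.
by have := enum_valP k; rewrite inE => /gt_eqF ->.
Qed.

Lemma unitary_coef_le1 U a b : U \is unitarymx -> `|U a b| <= 1.
Proof.
move=> /unitarymxP UU; rewrite -(@expr_le1 _ 2) //.
have := congr1 (fun M : 'M_D => M a a) UU; rewrite /= !mxE eqxx mulr1n => <-.
rewrite (bigD1 b) //= !mxE -normCK lerDl sumr_ge0 // => c _.
by rewrite !mxE -normCK exprn_ge0.
Qed.

Lemma sum_pos_part nu l U (K : F) :
  U \is unitarymx -> (#|[pred a | (0 < l a)%R]| <= nu)%N -> 0 <= K ->
  (forall a, l a <= K) ->
  exists X : 'M[F]_(nu, D),
    (forall v : 'cV_D, \sum_j `|(X *m v) j 0| ^+ 2 =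
       \sum_(a | 0 < l a) l a * `|(U *m v) a 0| ^+ 2) /\
    (forall j b, `|X j b| ^+ 2 <= K).
Proof.
move=> UU; rewrite cardE; set s := enum _ => sz K0 lK.
have sumE (v : 'cV_D) : \sum_(a | 0 < l a) l a * `|(U *m v) a 0| ^+ 2 =
    \sum_(a <- s) l a * `|(U *m v) a 0| ^+ 2 by rewrite big_enum.
have sP a : a \in s -> 0 < l a by rewrite mem_enum.
case: s => [|a0 s] in sz sumE sP *.
  exists 0; split => [v|j b]; last by rewrite mxE normr0 expr0n.
  by rewrite sumE big_nil big1 // => j _; rewrite mul0mx mxE normr0 expr0n.
move: (a0 :: s) sz sumE sP => {}s sz sumE sP; pose t := nth a0 s.
exists (\matrix_(j < nu, b < D) (if (j < size s)%N then
  sqrtC (l (t j)) * U (t j) b else 0)).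
have sqrtl j : (j < size s)%N -> `|sqrtC (l (t j))| ^+ 2 = l (t j).
  by move=> js; rewrite -normrX sqrtCK gtr0_norm //; apply/sP/mem_nth.
split=> [v|j b]; last first.
  rewrite mxE; case: ltnP => [js|_]; last by rewrite normr0 expr0n.
  rewrite normrM exprMn sqrtl //.
  apply: le_trans (lK (t j)); rewrite ler_piMr //.
    exact/ltW/sP/mem_nth.
  by rewrite expr_le1 ?unitary_coef_le1.
rewrite sumE (big_nth a0) big_mkord 
  (big_ord_widen nu (fun j => l (t j) * `|(U *m v) (t j) 0| ^+ 2)) //
  [RHS]big_mkcond /=.
apply: eq_bigr => j _; rewrite mxE; case: ltnP => [js|js]; last first.
  rewrite big1 ?normr0 ?expr0n // => b _.
  by rewrite mxE ltnNge js mul0r.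
have -> : \sum_b (\matrix_(j < nu, b < D) (if (j < size s)%N
    then sqrtC (l (t j)) * U (t j) b else 0)) j b * v b 0 =
    sqrtC (l (t j)) * (U *m v) (t j) 0.
  by rewrite mxE mulr_sumr; apply: eq_bigr => b _; rewrite mxE js mulrA.
by rewrite normrM exprMn sqrtl.
Qed.

(** Group the eigenvectors of the spectral theorem by the sign of the
    eigenvalue; the bound on the entries comes from the eigenvalues being at
    most the sum of the norms of the entries of [H]. *)
Theorem hermitian_split n1 n2 H (P1 : 'M[F]_(n1, D)) (P2 : 'M[F]_(n2, D)) :
  H^t* = H ->
  (forall v, P1 *m v = 0 -> qform H v <= 0) ->
  (forall v, P2 *m v = 0 -> 0 <= qform H v) ->
  exists (X : 'M[F]_(n1, D)) (Y : 'M[F]_(n2, D)),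
    (forall v, qform H v = \sum_j `|(X *m v) j 0| ^+ 2
                           - \sum_j `|(Y *m v) j 0| ^+ 2) /\
    ((forall j b, `|X j b| ^+ 2 <= \sum_a \sum_b `|H a b|) /\
     (forall j b, `|Y j b| ^+ 2 <= \sum_a \sum_b `|H a b|)).
Proof.
move=> HH neg pos; set K := \sum_a _.
have Hherm : H \is hermsymmx.
  by apply/is_hermitianmxP; rewrite expr0 scale1r HH.
pose U := spectralmx H; pose l a := spectral_diag H 0 a.
have UU : U \is unitarymx by apply: spectral_unitarymx.
have HE : H = U^t* *m diag_mx (spectral_diag H) *m U.
  by rewrite -invmx_unitary //; apply/orthomx_spectralP/hermitian_normalmx.
have lreal a : l a \is Num.real.
  by have /mxOverP := hermitian_spectral_diag_real Hherm; apply.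
have formE v : qform H v = \sum_a l a * `|(U *m v) a 0| ^+ 2.
  rewrite /qform HE -!mulmxA (mulmxA (v^t*)) -adjmx_mul mulmxA mxE.
  apply: eq_bigr => a _; rewrite mul_mx_diag !mxE normCK mulrAC mulrC.
  by rewrite [X in _ * X]mulrC !mulrA.
have lK a : `|l a| <= K.
  have -> : l a = (U *m H *m U^t*) a a.
    rewrite [in RHS]HE !mulmxA (unitarymxP UU) mul1mx -mulmxA.
    by rewrite (unitarymxP UU) mulmx1 mxE eqxx mulr1n.
  rewrite mxE; apply: le_trans (ler_norm_sum _ _ _) _.
  rewrite /K exchange_big; apply: ler_sum => b _ /=.
  rewrite mxE normrM !mxE norm_conjC.
  apply: le_trans (_ : `|\sum_j U a j * H j b| <= _).
    by rewrite ler_piMr // (unitary_coef_le1 _ _ UU).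
  apply: le_trans (ler_norm_sum _ _ _) _; apply: ler_sum => c _.
  by rewrite normrM ler_piMl // (unitary_coef_le1 _ _ UU).
have K0 : 0 <= K by apply: sumr_ge0 => a _; apply: sumr_ge0.
have [||X [XE XK]] := @sum_pos_part n1 l U K UU _ K0.
- by apply: (@card_pos_le n1 P1 l U UU) => v /neg; rewrite formE.
- by move=> a; rewrite (le_trans _ (lK a)) // real_ler_norm.
have [||Y [YE YK]] := @sum_pos_part n2 (fun a => - l a) U K UU _ K0.
- apply: (@card_pos_le n2 P2 (fun a => - l a) U UU) => v /pos.
  rewrite formE -oppr_le0 -sumrN.
  by under eq_bigr do rewrite -mulNr.
- by move=> a; rewrite (le_trans _ (lK a)) // -normrN real_ler_norm ?rpredN.
exists X, Y; split; last by [].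
move=> v; rewrite XE YE formE -sumrN.
rewrite (bigID (fun a => 0 < l a)) /=; congr (_ + _).
rewrite (bigID (fun a => l a == 0)) /= big1 ?add0r; last first.
  by move=> a /andP [_ /eqP ->]; rewrite mul0r.
apply: eq_big => [a|a _]; last by rewrite mulNr opprK.
by rewrite -real_leNgt ?real0 // oppr_gt0 lt_neqAle andbC.
Qed.

End Inertia.

(** * Matrix Fejer-Riesz factorization *)

Section ScalarFejerRiesz.
Variable F : numClosedFieldType.
Implicit Types p q : {poly F}.

(** Being real on the circle up to a power of [z], [p] has its zeros in pairs
    [b], [1 / conj b], and [(z - b) (z - 1 / conj b)] is a multiple of
    [z * |z - b|^2]. *)
Lemma circle_norm_square p (j l : nat) :
  (forall z, `|z| = 1 -> z ^+ j * p.[z] = z ^+ l * `|p.[z]|) ->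
  (forall z, `|z| = 1 -> p.[z] != 0) ->
  exists a : {poly F}, forall z, `|z| = 1 -> `|a.[z]| ^+ 2 = `|p.[z]|.
Proof.
have [k] := ubnP (size p); elim: k p j => // k IH p j.
rewrite ltnS => szp pre pn0.
have [sz1|] := eqVneq (size p) 1.
  have [c _ ->] := size_poly1P _ (introT eqP sz1).
  exists (sqrtC `|c|)%:P => z _.
  by rewrite !hornerC -normrX sqrtCK normr_id.
move=> /closed_rootP [b /factor_theorem [p1 pE]].
have [b0|b0] := eqVneq b 0.
  have pz z : p.[z] = z * p1.[z].
    by rewrite pE b0 subr0 hornerM hornerX mulrC.
  have [|z z1|z z1|a aP] := IH p1 j.+1.
  - rewrite (leq_trans _ szp) // pE b0 subr0 size_mulX //.
    apply/eqP => p10; move: (pn0 1 (normr1 _)).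
    by rewrite pz p10 horner0 mulr0 eqxx.
  - have := pre z z1; rewrite pz normrM z1 mul1r => <-.
    by rewrite exprSr mulrA.
  - by have := pn0 z z1; rewrite pz mulf_eq0 negb_or => /andP [].
  by exists a => z z1; rewrite pz normrM z1 mul1r aP.
have pc z : `|z| = 1 -> z ^+ (j + j) * p.[z] = z ^+ (l + l) * (p.[z])^*.
  move=> z1; have := pre z z1; have /(congr1 (@Num.conj F)) := pre z z1.
  rewrite !rmorphM !rmorphXn /= conj_circle // (CrealP (normr_real _)).
  have z0 := circle_neq0 z1; rewrite !exprVn => E1 E2.
  have zj i : z ^+ i != 0 by rewrite expf_neq0.
  have E3 : z ^+ l * p.[z]^* = z ^+ j * `|p.[z]|.
    by rewrite -[p.[z]^*](mulVKf (zj j)) E1 mulrCA mulVKf.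
  by rewrite !exprD -!mulrA E2 E3 mulrCA.
pose b' := (b^*)^-1; have bc0 : b^* != 0 by rewrite conjC_eq0.
have b'0 : b' != 0 by rewrite invr_eq0.
have pb' : p.[b'] = 0.
  have := @circle_continuation _ 'I_1 'I_1 (fun _ => 'X^(j + j) * p)
    (fun _ => 1) (fun _ => 'X^(l + l)) (fun _ => p) _ b' b'0.
  rewrite !big_ord1 !hornerM !hornerXn hornerC rmorph1 mulr1.
  have -> : (b'^*)^-1 = b by rewrite /b' fmorphV /= conjCK invrK.
  have -> : p.[b] = 0 by rewrite pE hornerM hornerXsubC subrr mulr0.
  rewrite rmorph0 mulr0 => H; apply/eqP; move: H => /(_ _)/eqP.
  rewrite mulf_eq0 expf_eq0 (negPf b'0) andbF /=; apply=> z z1.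
  by rewrite !big_ord1 !hornerM !hornerXn hornerC rmorph1 mulr1 pc.
have b1 : `|b| != 1.
  apply/eqP => b1; have := pn0 b b1.
  by rewrite pE hornerM hornerXsubC subrr mulr0 eqxx.
have bb' : b' - b != 0.
  rewrite subr_eq0; apply/eqP => bb'; case/eqP: b1; apply/eqP.
  by rewrite -(@eqrXn2 _ 2) // expr1n normCK -{1}bb' mulVf.
have /factor_theorem [p2 p1E] : root p1 b'.
  move: pb'; rewrite pE hornerM hornerXsubC => /eqP.
  by rewrite mulf_eq0 (negPf bb') orbF.
pose p3 := - b' *: p2.
have pz z : `|z| = 1 -> p.[z] = z * `|z - b| ^+ 2 * p3.[z].
  move=> z1; rewrite normCK rmorphB /= conj_circle // pE p1E /p3 /b'.
  rewrite !(hornerM, hornerXsubC, hornerZ).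
  by field; rewrite bc0 circle_neq0.
have zb z : `|z| = 1 -> 0 < `|z - b| ^+ 2.
  move=> z1; rewrite exprn_gt0 // normr_gt0 subr_eq0.
  by apply: contra b1 => /eqP <-; rewrite z1.
have pn z : `|z| = 1 -> `|p.[z]| = `|z - b| ^+ 2 * `|p3.[z]|.
  by move=> z1; rewrite pz // 2!normrM z1 mul1r (ger0_norm (ltW (zb z z1))).
have [|z z1|z z1|a aP] := IH p3 j.+1.
- have p20 : p2 != 0.
    apply/eqP => p20; move: (pn0 1 (normr1 _)).
    by rewrite pE p1E p20 !mul0r horner0 eqxx.
  rewrite (leq_trans _ szp) // /p3 size_scale ?oppr_eq0 // pE p1E.
  rewrite !size_Mmonic ?monicXsubC ?mulf_neq0 ?polyXsubC_eq0 //.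
  by rewrite !size_XsubC !addn2.
- have E := pre z z1; rewrite pn // pz // in E.
  apply: (mulfI (lt0r_neq0 (zb z z1))).
  by rewrite [RHS]mulrCA -E (exprSr z); ring.
- by have := pn0 z z1; rewrite pz // mulf_eq0 negb_or => /andP [].
exists (('X - b%:P) * a) => z z1; rewrite hornerM hornerXsubC normrM exprMn.
by rewrite aP // pn.
Qed.

Lemma fejer_riesz_scalar p n : (forall z, `|z| = 1 -> 0 < z ^- n * p.[z]) ->
  exists a : {poly F}, forall z, `|z| = 1 -> `|a.[z]| ^+ 2 = z ^- n * p.[z].
Proof.
move=> pos.
have E z : `|z| = 1 -> z ^- n * p.[z] = `|p.[z]|.
  move=> z1; rewrite -(ger0_norm (ltW (pos z z1))) normrM normfV normrX z1.
  by rewrite expr1n invr1 mul1r.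
have [z z1|z z1|a aP] := @circle_norm_square p 0 n.
- by rewrite -E // mulrA divff ?expf_neq0 ?circle_neq0.
- by have := pos z z1; rewrite lt0r mulf_eq0 negb_or -andbA => /and3P [].
- by exists a => z z1; rewrite aP // E.
Qed.

(** [|1 - conj(a) z| = |z - a|] on the circle, so each factor ['X - a] with
    [a] in the disk can be replaced by [1 - conj(a) 'X]. *)
Lemma reflect_zeros q : (forall z, `|z| = 1 -> q.[z] != 0) ->
  exists q' : {poly F}, (forall z, `|z| = 1 -> `|q'.[z]| = `|q.[z]|) /\
    (forall z, `|z| <= 1 -> q'.[z] != 0).
Proof.
move=> q0; have [s qE] := closed_field_poly_normal q.
have c0 : lead_coef q != 0.
  rewrite lead_coef_eq0; apply/eqP => q00; move: (q0 1 (normr1 _)).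
  by rewrite q00 horner0 eqxx.
have : all (fun a => `|a| != 1) s.
  apply/allP => a sa; apply/eqP => a1; have := q0 a a1.
  rewrite qE hornerZ mulf_eq0 negb_or c0 /= -[_.[_] == 0]/(root _ _).
  by rewrite root_prod_XsubC sa.
rewrite qE; move: (lead_coef q) c0 => c c0 {q0 qE}.
suff H : all (fun a => `|a| != 1) s ->
    exists q', (forall z, `|z| = 1 ->
      `|q'.[z]| = `|(\prod_(a <- s) ('X - a%:P)).[z]|) /\
    (forall z, `|z| <= 1 -> q'.[z] != 0).
  move=> /H [q' [q'E q'0]]; exists (c *: q'); split=> z zP.
    by rewrite !hornerZ !normrM q'E.
  by rewrite hornerZ mulf_neq0 ?q'0.
elim: s => [|a s IH] /=.
  move=> _; exists 1; split=> z _; rewrite ?big_nil //.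
  by rewrite hornerC oner_eq0.
move=> /andP [a1 /IH [q' [q'E q'0]]].
have [a1'|a1'] := real_leP (normr_real a) (real1 F); last first.
  exists (('X - a%:P) * q'); split=> z zP.
    by rewrite big_cons !hornerM !normrM q'E.
  rewrite hornerM mulf_neq0 ?q'0 // hornerXsubC subr_eq0.
  by apply: contraTneq a1' => <-; rewrite -real_leNgt ?normr_real ?real1.
exists ((1 - a^* *: 'X) * q'); split=> z zP.
  rewrite big_cons !hornerM !normrM q'E //; congr (_ * _).
  have -> : (1 - a^* *: 'X).[z] = z * (z - a)^*.
    rewrite !hornerE rmorphB /= (conj_circle zP) mulrBr.
    by rewrite divff ?circle_neq0 // [z * _]mulrC.
  by rewrite normrM zP mul1r norm_conjC !hornerE.
rewrite hornerM mulf_neq0 ?q'0 // !hornerE subr_eq0.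
apply/eqP => /(congr1 (fun x => `|x|)); rewrite normr1 normrM norm_conjC => E.
have : `|a| * `|z| < 1.
  apply: le_lt_trans (_ : `|a| < 1); first by rewrite ler_piMr.
  by rewrite lt_neqAle a1.
by rewrite -E ltxx.
Qed.

End ScalarFejerRiesz.

Section MatrixFejerRiesz.
Variable F : numClosedFieldType.

Lemma adjmxD m n (A B : 'M[F]_(m, n)) : (A + B)^t* = A^t* + B^t*.
Proof. by apply/matrixP => i j; rewrite !mxE rmorphD. Qed.

Lemma adjmxZ m n (c : F) (A : 'M[F]_(m, n)) : (c *: A)^t* = c^* *: A^t*.
Proof. by apply/matrixP => i j; rewrite !mxE rmorphM. Qed.

Definition posdef m (T : 'M[F]_m) : Prop :=
  T^t* = T /\ forall v, v != 0 -> 0 < qform T v.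

Lemma posdefZ m (T : 'M[F]_m) (c : F) : 0 < c -> posdef T -> posdef (c *: T).
Proof.
move=> c0 [TT Tpos]; split.
  by rewrite linearZ /= map_mxZ TT /= (CrealP (gtr0_real c0)).
move=> v v0; rewrite /qform -scalemxAr -scalemxAl mxE.
by rewrite mulr_gt0 // Tpos.
Qed.

Section Schur.
Variables (m : nat) (T : 'M[F]_(1 + m)).
Hypothesis Tpos : posdef T.

Lemma posdef_00 : 0 < T 0 0.
Proof.
case: Tpos => _ /(_ (delta_mx 0 0)); rewrite qformE.
rewrite (bigD1 0) //= (bigD1 0) //= !mxE eqxx rmorph1 !mul1r.
rewrite !big1 ?addr0.
- apply; apply/eqP => /matrixP /(_ 0 0); rewrite !mxE eqxx => /eqP.
  by rewrite oner_eq0.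
- move=> i i0; rewrite big1 // => j _.
  by rewrite !mxE (negPf i0) /= rmorph0 !mul0r.
- by move=> j j0; rewrite !mxE (negPf j0) /= mulr0 mul0r.
Qed.

Definition schur : 'M[F]_m :=
  T 0 0 *: drsubmx T - dlsubmx T *m ursubmx T.

Lemma herm_blocks :
  [/\ (T 0 0)^* = T 0 0, (ursubmx T)^t* = dlsubmx T,
      (dlsubmx T)^t* = ursubmx T & (drsubmx T)^t* = drsubmx T].
Proof.
case: Tpos => TT _; split.
- by rewrite -[in RHS]TT !mxE.
- by rewrite -[in RHS]TT; apply/matrixP => i j; rewrite !mxE.
- by rewrite -[in RHS]TT; apply/matrixP => i j; rewrite !mxE.
- by rewrite -[in RHS]TT; apply/matrixP => i j; rewrite !mxE.
Qed.

Lemma ulsubmx_scalar : ulsubmx T = (T 0 0)%:M.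
Proof.
by rewrite [LHS]mx11_scalar !mxE; congr ((T _ _)%:M); apply: val_inj.
Qed.

(** Up to the factor [T 0 0], the Schur complement is the restriction of the
    form to the orthogonal, with respect to it, of the first basis vector. *)
Lemma schur_posdef : posdef schur.
Proof.
have [aR bc cb dd] := herm_blocks; have a0 := posdef_00; split.
  rewrite /schur linearB /= map_mxB linearZ /= map_mxZ /= aR dd.
  by rewrite adjmx_mul bc cb.
move=> v v0; pose x := col_mx (- (ursubmx T *m v)) (T 0 0 *: v).
have x0 : x != 0.
  apply: contra v0 => /eqP; rewrite -col_mx0 => /eq_col_mx [_ /eqP].
  by rewrite scaler_eq0 (gt_eqF a0).
have := Tpos.2 x x0; suff -> : qform T x = T 0 0 * qform schur v.
  by rewrite pmulr_rgt0.
rewrite /qform -!mulmxA.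
have -> : T *m x = col_mx 0 (schur *m v).
  rewrite -[T in LHS]submxK mul_block_col ulsubmx_scalar mul_scalar_mx.
  rewrite scalerN -scalemxAr addNr; congr col_mx.
  by rewrite mulmxN -scalemxAr addrC mulmxBl -scalemxAl mulmxA.
rewrite tr_col_mx map_row_mx mul_row_col mulmx0 add0r.
by rewrite linearZ /= map_mxZ /= aR -scalemxAl mxE.
Qed.

Lemma schur_factor (k : F) (Y : 'M[F]_m) :
  Y^t* *m Y = `|k| ^+ 2 *: schur ->
  let X := block_mx (k *: ulsubmx T) (k *: ursubmx T) 0 Y in
  X^t* *m X = (`|k| ^+ 2 * T 0 0) *: T.
Proof.
have [aR bc cb dd] := herm_blocks.
move=> YY X; rewrite /X tr_block_mx map_block_mx mulmx_block.
rewrite !trmx0 !map_mx0 !mulmx0 !mul0mx !addr0 YY.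
rewrite !linearZ /= !map_mxZ -!scalemxAl !scalerA bc.
rewrite -[X in _ = _ *: X](submxK T) scale_block_mx ulsubmx_scalar.
rewrite tr_scalar_mx map_scalar_mx /= aR !mul_scalar_mx !mul_mx_scalar.
rewrite -!normCK !scalerA; congr block_mx.
by rewrite /schur scalerBr !scalerA addrC subrK.
Qed.

End Schur.

(** Gaussian elimination by Schur complements: each pivot is a positive scalar
    trigonometric polynomial, hence a square [|a|^2], and clearing the
    denominators only multiplies [q]. *)
Lemma fejer_riesz_denominator m n (P : 'M[{poly F}]_m) :
  (forall z, `|z| = 1 -> posdef (z ^- n *: ev z P)) ->
  exists (q : {poly F}) (X : 'M[{poly F}]_m), forall z, `|z| = 1 ->
    q.[z] != 0 /\
    (ev z X)^t* *m ev z X = `|q.[z]| ^+ 2 *: (z ^- n *: ev z P).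
Proof.
elim: m n P => [|m IH] n P pos.
  exists 1, 0 => z _; rewrite hornerC oner_eq0; split=> //.
  by apply/matrixP => -[].
rewrite -[m.+1]/(1 + m)%N in P pos *.
have [z z1|a aP] := @fejer_riesz_scalar _ (P 0 0) n.
  have := posdef_00 (pos z z1); by rewrite !mxE.
pose S := P 0 0 *: drsubmx P - dlsubmx P *m ursubmx P.
have SE z : z ^- (n + n) *: ev z S = schur (z ^- n *: ev z P).
  rewrite /schur /S map_mxB map_mxZ map_mxM scalerBr exprD invfM.
  rewrite !map_drsubmx map_dlsubmx map_ursubmx !mxE.
  have drZ (c : F) (A : 'M_(1 + m)) : drsubmx (c *: A) = c *: drsubmx A.
    by apply/matrixP => i j; rewrite !mxE.
  have dlZ (c : F) (A : 'M_(1 + m)) : dlsubmx (c *: A) = c *: dlsubmx A.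
    by apply/matrixP => i j; rewrite !mxE.
  have urZ (c : F) (A : 'M_(1 + m)) : ursubmx (c *: A) = c *: ursubmx A.
    by apply/matrixP => i j; rewrite !mxE.
  rewrite drZ dlZ urZ -scalemxAl -scalemxAr !scalerA.
  by congr (_ *: _ - _); rewrite -!mulrA; congr (_ * _); rewrite mulrC.
have [z z1|q [Y YP]] := IH (n + n)%N S.
  by rewrite SE; apply/schur_posdef/pos.
have T00 z : `|z| = 1 -> (z ^- n *: ev z P) 0 0 = `|a.[z]| ^+ 2.
  by move=> z1; rewrite !mxE aP.
exists (a * q), (block_mx (q *: ulsubmx P) (q *: ursubmx P) 0 Y) => z z1.
have [q0 YE] := YP z z1; split.
  rewrite hornerM mulf_neq0 //; apply/eqP => a0.
  by have := posdef_00 (pos z z1); rewrite T00 // a0 normr0 expr0n ltxx.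
have z0 : z ^+ n != 0 by rewrite expf_neq0 // circle_neq0.
rewrite SE in YE.
have nk : `|q.[z]| = `|q.[z] * z ^+ n|.
  by rewrite normrM normrX z1 expr1n mulr1.
rewrite nk in YE; have := schur_factor (pos z z1) YE.
rewrite /= -nk T00 // hornerM normrM exprMn [_ ^+ 2 * _]mulrC => <-.
have -> : ev z (block_mx (q *: ulsubmx P) (q *: ursubmx P) 0 Y) =
    block_mx ((q.[z] * z ^+ n) *: ulsubmx (z ^- n *: ev z P))
      ((q.[z] * z ^+ n) *: ursubmx (z ^- n *: ev z P)) 0 (ev z Y).
  rewrite map_block_mx map_mx0; congr block_mx; apply/matrixP => i j.
    by rewrite !mxE /horner_eval hornerM mulrA mulfK.
  by rewrite !mxE /horner_eval hornerM mulrA mulfK.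
by [].
Qed.

(** Two factorizations of the block matrix with rows [1, -v] and [u, 1]. *)
Lemma det_one_plus (R : comNzRingType) m (u : 'cV[R]_m) (v : 'rV[R]_m) :
  \det (1%:M + u *m v) = 1 + (v *m u) 0 0.
Proof.
pose A := block_mx (1%:M : 'M_1) (- v) u (1%:M : 'M_m).
have -> : 1 + (v *m u) 0 0 = \det A.
  have -> : A = block_mx (1%:M + v *m u) (- v) 0 1%:M *m block_mx 1%:M 0 u 1%:M.
    rewrite mulmx_block !mulmx1 !mulmx0 ?mul0mx !mul1mx !add0r mulNmx.
    by rewrite addrK.
  rewrite det_mulmx det_ublock det_lblock !det1 !mulr1.
  by rewrite [_ + _ in RHS]mx11_scalar det_scalar1 !mxE eqxx.
have -> : A = block_mx 1%:M 0 u 1%:M *m block_mx 1%:M (- v) 0 (1%:M + u *m v).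
  rewrite mulmx_block !mulmx1 !mulmx0 ?mul0mx !mul1mx ?addr0 mulmxN.
  by rewrite [- _ + _]addrC addrK.
by rewrite det_mulmx det_ublock det_lblock !det1 !mul1r.
Qed.

(** The matrix [1 + (f - 1) u* u], which multiplies the line of the unit row
    [u] by [f] and is the identity on its orthogonal. *)
Definition line_scaling m (u : 'rV[F]_m) (f : {poly F}) : 'M[{poly F}]_m :=
  1%:M + map_mx polyC (u^t*) *m ((f - 1) *: map_mx polyC u).

Section LineScaling.
Variables (m : nat) (u : 'rV[F]_m).
Hypothesis u1 : u *m u^t* = 1%:M.

Lemma det_line_scaling f : \det (line_scaling u f) = f.
Proof.
rewrite det_one_plus -scalemxAl -map_mxM u1 !mxE eqxx mulr1.
by rewrite addrC subrK.
Qed.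

Lemma gram_line_scaling f z :
  (ev z (line_scaling u f))^t* *m ev z (line_scaling u f) =
  1%:M + (`|f.[z]| ^+ 2 - 1) *: (u^t* *m u).
Proof.
have -> : ev z (line_scaling u f) = 1%:M + (f.[z] - 1) *: (u^t* *m u).
  apply/matrixP => i j; rewrite !mxE /horner_eval hornerD hornerMn hornerC.
  by congr (_ + _); rewrite !big_ord1 !mxE !hornerE /= [(u _ _)^* * _]mulrC.
have -> : (1%:M + (f.[z] - 1) *: (u^t* *m u))^t* =
    1%:M + (f.[z] - 1)^* *: (u^t* *m u).
  by rewrite adjmxD adjmxZ adjmx_mul trmxCK tr_scalar_mx map_mx1.
rewrite mulmxDl mul1mx mulmxDr mulmx1 -scalemxAl -scalemxAr scalerA.
rewrite -(mulmxA _ u) (mulmxA u) u1 mul1mx -addrA -scalerDl -scalerDl.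
congr (_ + _ *: _); rewrite normCK rmorphB rmorph1 /=; ring.
Qed.

End LineScaling.

End MatrixFejerRiesz.

Section OuterFactor.
Variable F : numClosedFieldType.

(** At a zero [a] of the determinant some unit row [u] annihilates [X], so
    that the factor ['X - a] splits off on the line of [u]. *)
Lemma extract_line m (X : 'M[{poly F}]_m) a : root (\det X) a ->
  exists (u : 'rV[F]_m) (Y : 'M[{poly F}]_m),
    u *m u^t* = 1%:M /\ X = line_scaling u ('X - a%:P) *m Y.
Proof.
move=> Xa; have /det0P [v v0 vX] : \det (ev a X) == 0 by rewrite det_map_mx.
pose c := (v *m v^t*) 0 0.
have cE : c = \sum_j `|v 0 j| ^+ 2.
  by rewrite /c mxE; apply: eq_bigr => j _; rewrite !mxE normCK.
have c0 : 0 < c.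
  rewrite lt0r cE sumr_ge0 ?andbT => [|j _]; last by rewrite exprn_ge0.
  apply: contra v0 => /eqP; move/psumr_eq0P => H; apply/eqP/rowP => j.
  rewrite mxE; apply/eqP; rewrite -normr_eq0 -sqrf_eq0 H // => i _.
  by rewrite exprn_ge0.
pose b := (sqrtC c)^-1; pose u := b *: v.
have u1 : u *m u^t* = 1%:M.
  rewrite /u adjmxZ -scalemxAl -scalemxAr scalerA [_ *m _]mx11_scalar -/c.
  rewrite -normCK /b normfV exprVn -normrX sqrtCK (gtr0_norm c0).
  by rewrite scale_scalar_mx mulVf ?gt_eqF.
have uX : u *m ev a X = 0 by rewrite /u -scalemxAl vX scaler0.
pose g := map_mx (fun p => p %/ ('X - a%:P)) (map_mx polyC u *m X).
have gE : map_mx polyC u *m X = ('X - a%:P) *: g.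
  apply/rowP => j; rewrite scalemx_coef [g 0 j]mxE mulrC divpK //.
  rewrite dvdp_XsubCl; apply/eqP.
  have := congr1 (fun M : 'rV_m => M 0 j) uX; rewrite /= !mxE => <-.
  rewrite horner_sum; apply: eq_bigr => i _.
  by rewrite !mxE hornerM hornerC.
exists u, (X + map_mx polyC (u^t*) *m (g - map_mx polyC u *m X)); split=> //.
set U := map_mx polyC (u^t*); set V := map_mx polyC u.
have VU : V *m U = 1%:M by rewrite -map_mxM u1 map_mx1.
have VY : V *m (X + U *m (g - V *m X)) = g.
  by rewrite [LHS]mulmxDr mulmxA VU mul1mx addrC subrK.
rewrite /line_scaling -/U -/V mulmxDl mul1mx -mulmxA -scalemxAl VY.
rewrite -addrA -mulmxDr -[LHS]addr0; congr (_ + _).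
by rewrite scalerBl scale1r -gE addrA subrK subrr mulmx0.
Qed.

Lemma gram_mul m (A B : 'M[{poly F}]_m) z :
  (ev z (A *m B))^t* *m ev z (A *m B) =
  (ev z B)^t* *m ((ev z A)^t* *m ev z A) *m ev z B.
Proof. by rewrite map_mxM adjmx_mul !mulmxA. Qed.

(** The zeros in the disk of the determinant are moved outside one by one, by
    replacing ['X - a] on the line of [u] by [1 - conj(a) 'X], which has the
    same modulus on the circle. *)
Lemma zeros_outside m (s : seq F) (h : {poly F}) (X : 'M[{poly F}]_m) :
  \det X = \prod_(a <- s) ('X - a%:P) * h ->
  all (fun a => `|a| < 1) s ->
  (forall z, `|z| < 1 -> h.[z] != 0) ->
  exists Y : 'M[{poly F}]_m,
    (forall z, `|z| = 1 -> (ev z Y)^t* *m ev z Y = (ev z X)^t* *m ev z X) /\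
    (forall z, `|z| < 1 -> (\det Y).[z] != 0).
Proof.
elim: s h X => [|a s IH] h X.
  by rewrite big_nil mul1r => <- _ h0; exists X.
rewrite big_cons -mulrA => dX /andP [a1 s1] h0.
have [|u [Y [u1 XE]]] := @extract_line m X a.
  by rewrite dX rootM root_XsubC eqxx.
have dY : \det Y = \prod_(a <- s) ('X - a%:P) * h.
  apply: (@mulfI _ ('X - a%:P)); first by rewrite polyXsubC_eq0.
  by rewrite -dX {1}XE det_mulmx det_line_scaling.
have [|||Z [ZE Z0]] := IH ((1 - a^* *: 'X) * h)
    (line_scaling u (1 - a^* *: 'X) *m Y).
- by rewrite det_mulmx det_line_scaling // dY mulrCA.
- by [].
- move=> z z1; rewrite hornerM mulf_neq0 ?h0 // !hornerE subr_eq0.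
  apply/eqP => /(congr1 (fun x => `|x|)); rewrite normr1 normrM norm_conjC => E.
  have : `|a| * `|z| < 1.
    apply: le_lt_trans (_ : `|a| < 1) => //.
    by rewrite ler_piMr // ltW.
  by rewrite -E ltxx.
exists Z; split=> // z z1; rewrite ZE // XE !gram_mul !gram_line_scaling //.
suff -> : `|(1 - a^* *: 'X).[z]| = `|('X - a%:P).[z]| by [].
have -> : (1 - a^* *: 'X).[z] = z * (z - a)^*.
  rewrite !hornerE rmorphB /= (conj_circle z1) mulrBr.
  by rewrite divff ?circle_neq0 // [z * _]mulrC.
by rewrite normrM z1 mul1r norm_conjC !hornerE.
Qed.

Lemma gram_entry m (X : 'M[{poly F}]_m) z i j :
  ((ev z X)^t* *m ev z X) i j = \sum_k (X k j).[z] * ((X k i).[z])^*.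
Proof. by rewrite mxE; apply: eq_bigr => k _; rewrite !mxE mulrC. Qed.

(** The continuation to [z] of the identity on the circle has the factor
    [q(z)]. *)
Lemma gram_continuation m n (X P : 'M[{poly F}]_m) (q : {poly F}) :
  (forall z, `|z| = 1 ->
     (ev z X)^t* *m ev z X = `|q.[z]| ^+ 2 *: (z ^- n *: ev z P)) ->
  forall z, z != 0 -> root q z -> (ev (z^*)^-1 X)^t* *m ev z X = 0.
Proof.
move=> E z z0 /rootP qz; apply/matrixP => i j; rewrite mxE.
have := @circle_continuation _ 'I_m 'I_1 (fun k => X k j) (fun k => X k i)
    (fun _ => q * P i j) (fun _ => q * 'X^n) _ z z0.
rewrite big_ord1 hornerM qz !mul0r => H; rewrite [RHS]mxE -[RHS]H => [|x x1].
  by apply: eq_bigr => k _; rewrite !mxE mulrC.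
have := congr1 (fun M : 'M_m => M i j) (E x x1); rewrite /= gram_entry => ->.
rewrite big_ord1 !mxE !hornerM hornerXn rmorphM rmorphXn /= (conj_circle x1).
by rewrite normCK exprVn /horner_eval; ring.
Qed.

(** At a zero [a] of [q], which lies outside the closed disk, [X] vanishes
    because the reflected factor is invertible at [1 / conj a]. *)
Lemma cancel_denominator m n (X P : 'M[{poly F}]_m) (q : {poly F}) :
  (forall z, `|z| = 1 ->
     (ev z X)^t* *m ev z X = `|q.[z]| ^+ 2 *: (z ^- n *: ev z P)) ->
  (forall z, `|z| <= 1 -> q.[z] != 0) ->
  (forall z, `|z| < 1 -> (\det X).[z] != 0) ->
  exists Y : 'M[{poly F}]_m,
    (forall z, `|z| = 1 -> (ev z Y)^t* *m ev z Y = z ^- n *: ev z P) /\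
    (forall z, `|z| < 1 -> (\det Y).[z] != 0).
Proof.
have [k] := ubnP (size q); elim: k q X => // k IH q X; rewrite ltnS => szq.
move=> E q0 X0; have [sz1|] := eqVneq (size q) 1.
  have [c c0 qE] := size_poly1P _ (introT eqP sz1).
  exists (c^-1%:P *: X); split=> z z1.
    rewrite map_mxZ /= /horner_eval hornerC adjmxZ -scalemxAl -scalemxAr.
    rewrite E // qE hornerC !scalerA normCK fmorphV /=.
    by rewrite mulrA divfK // mulVf ?conjC_eq0 // mul1r.
  rewrite detZ hornerM horner_exp hornerC mulf_neq0 ?X0 //.
  by rewrite expf_neq0 // invr_eq0.
move=> /closed_rootP [a qa].
have a1 : 1 < `|a|.
  rewrite real_ltNge ?real1 ?normr_real //.
  by apply: contraTN qa => /q0.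
have a0 : a != 0 by rewrite -normr_gt0 (lt_trans ltr01).
have XXa := gram_continuation E a0 qa.
have Xa : ev a X = 0.
  have : (ev (a^*)^-1 X)^t* \in unitmx.
    rewrite map_unitmx unitmx_tr unitmxE det_map_mx unitfE /horner_eval.
    rewrite X0 // normfV norm_conjC invf_lt1 //.
    exact: lt_trans a1.
  by move=> U; rewrite -[LHS](mulKmx U) XXa mulmx0.
have [q1 qE] := factor_theorem _ _ qa.
pose Y := map_mx (fun p => p %/ ('X - a%:P)) X.
have XE : X = ('X - a%:P) *: Y.
  apply/matrixP => i j; rewrite scalemx_coef [Y i j]mxE mulrC divpK //.
  rewrite dvdp_XsubCl; apply/rootP.
  by have := congr1 (fun M : 'M_m => M i j) Xa; rewrite /= !mxE.
have qn0 : q1 != 0.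
  apply/eqP => q10; have := q0 0; rewrite normr0 qE q10 mul0r horner0 eqxx.
  by move/(_ ler01).
have za z : `|z| <= 1 -> z - a != 0.
  move=> z1; rewrite subr_eq0; apply: contraTneq a1 => <-.
  by rewrite -real_leNgt ?normr_real ?real1.
apply: (IH q1 Y) => [|z z1|z z1|z z1].
- by rewrite qE size_Mmonic ?monicXsubC // size_XsubC addn2 in szq.
- have := E z z1; rewrite XE map_mxZ /= /horner_eval hornerXsubC adjmxZ.
  rewrite -scalemxAl -scalemxAr scalerA mulrC -normCK qE hornerM hornerXsubC.
  rewrite normrM exprMn => E1; have za0 : `|z - a| ^+ 2 != 0.
    by rewrite expf_neq0 // normr_eq0 za // z1.
  by apply: (scalerI za0); rewrite E1 [RHS]scalerA [X in _ = X *: _]mulrC.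
- by have := q0 z z1; rewrite qE hornerM mulf_eq0 negb_or => /andP [].
- have := X0 z z1; rewrite XE detZ hornerM mulf_eq0 negb_or.
  by move=> /andP [].
Qed.

Lemma crev_Xn K n : (n <= K)%N -> crev K 'X^n = 'X^(K - n) :> {poly F}.
Proof.
move=> nK; apply/polyP => k; rewrite coef_poly !coefXn ltnS.
case: leqP => [kK|Kk].
  rewrite conjC_nat; congr (_ %:R).
  by congr nat_of_bool; apply/eqP/eqP => [<-|->]; rewrite subKn.
by rewrite gtn_eqF // (leq_ltn_trans _ Kk) // leq_subr.
Qed.

(** [det Y] does not vanish at the origin, so in
    [Y~ Y = 'X^(K - n) P], where [Y~] is the reflection of [Y], the matrix
    [Y~] itself is divisible by ['X^(K - n)]. *)
Lemma outer_factor_size m n (Y P : 'M[{poly F}]_m) :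
  (forall z, `|z| = 1 -> (ev z Y)^t* *m ev z Y = z ^- n *: ev z P) ->
  (\det Y).[0] != 0 -> size_mx_le n.+1 Y.
Proof.
move=> E Y0.
have [K0 K0P] := size_bound (fun ij : 'I_m * 'I_m => Y ij.1 ij.2).
pose K := maxn n K0; have nK : (n <= K)%N by apply: leq_maxl.
have sY i j : (size (Y i j) <= K.+1)%N.
  by rewrite leqW // (leq_trans (K0P (i, j))) // leq_maxr.
pose Yr : 'M[{poly F}]_m := \matrix_(i, k) crev K (Y k i).
have YrY : Yr *m Y = 'X^(K - n) *: P.
  apply/matrixP => i j; rewrite !mxE.
  have := @circle_identity _ 'I_m 'I_1 K (fun k => Y k j) (fun k => Y k i)
    (fun _ => P i j) (fun _ => 'X^n) _ _ _.
  rewrite big_ord1 crev_Xn // [RHS]mulrC => <- //.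
  - by apply: eq_bigr => k _; rewrite mxE mulrC.
  - by move=> _; rewrite size_polyXn ltnS.
  - move=> z z1; have := congr1 (fun M : 'M_m => M i j) (E z z1).
    rewrite /= gram_entry => ->.
    by rewrite big_ord1 !mxE hornerXn rmorphXn /= (conj_circle z1) exprVn mulrC.
have YrE : \det Y *: Yr = 'X^(K - n) *: (P *m \adj Y).
  by rewrite scalemxAl -YrY -mulmxA mul_mx_adj mul_mx_scalar.
move=> k i; apply/leq_sizeP => l nl.
have [Kl|lK] := ltnP K l.
  by rewrite nth_default // (leq_trans (sY k i)).
have : 'X^(K - n) %| crev K (Y k i).
  have : 'X^(K - n) %| \det Y * crev K (Y k i).
    have := congr1 (fun M : 'M_m => M i k) YrE; rewrite /= !scalemx_coef.
    by rewrite [Yr i k]mxE => ->; rewrite dvdp_mulr.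
  by rewrite Gauss_dvdpr // coprimep_expl // coprimep_sym coprimepX.
move=> /dvdpP [h hE].
have : (crev K (Y k i))`_(K - l) = 0.
  by rewrite hE coefMXn ltn_sub2l // (leq_trans nl).
rewrite coef_poly ltnS leq_subr subKn // => /eqP.
by rewrite conjC_eq0 => /eqP.
Qed.

(** Factor over a denominator [q], make [q] zero-free in the closed disk, move
    the zeros of [det X] out of the disk, and then [q] divides out. On the
    circle itself [det Y] does not vanish because [Y* Y] is definite. *)
Theorem fejer_riesz m n (P : 'M[{poly F}]_m) :
  (forall z, `|z| = 1 -> posdef (z ^- n *: ev z P)) ->
  exists Y : 'M[{poly F}]_m,
    [/\ size_mx_le n.+1 Y,
        forall z, `|z| = 1 -> (ev z Y)^t* *m ev z Y = z ^- n *: ev z P &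
        forall z, `|z| <= 1 -> (\det Y).[z] != 0].
Proof.
move=> pos; have [q [X qX]] := fejer_riesz_denominator pos.
have [q' [q'E q'0]] := reflect_zeros (fun z z1 => (qX z z1).1).
have X0 z : `|z| = 1 -> (\det X).[z] != 0.
  move=> z1; have [q0 XE] := qX z z1; apply/eqP => dX.
  have /det0P [v v0 vX] : \det (ev z X)^T == 0.
    by rewrite det_tr det_map_mx /= /horner_eval dX.
  have Xv : ev z X *m v^T = 0.
    by apply: trmx_inj; rewrite trmx_mul trmxK vX trmx0.
  have := (posdefZ (_ : 0 < `|q.[z]| ^+ 2) (pos z z1)).2 v^T.
  rewrite -XE /qform -!mulmxA Xv !mulmx0 mxE ltxx => H.
  have /H : 0 < `|q.[z]| ^+ 2 by rewrite exprn_gt0 // normr_gt0.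
  by rewrite -trmx0 (inj_eq trmx_inj) v0 => /(_ isT).
have dX0 : \det X != 0.
  by apply/eqP => dX; have := X0 1 (normr1 _); rewrite dX horner0 eqxx.
have [s dXE] := closed_field_poly_normal (\det X).
pose inD := fun a : F => `|a| < 1.
have [||| Z [ZE Z0]] := @zeros_outside m [seq a <- s | inD a]
    (lead_coef (\det X) *: \prod_(a <- [seq a <- s | ~~ inD a]) ('X - a%:P)) X.
- rewrite {1}dXE -scalerAr -big_cat; congr (_ *: _).
  by apply: perm_big; rewrite perm_sym perm_filterC.
- by apply: filter_all.
- move=> z z1; rewrite hornerZ mulf_neq0 ?lead_coef_eq0 //.
  rewrite -[_.[_] == 0]/(root _ _) root_prod_XsubC mem_filter.
  by rewrite /inD z1.
have [|Y [YE Y0]] := @cancel_denominator m n Z P q' _ q'0 Z0.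
  by move=> z z1; rewrite ZE // (qX z z1).2 q'E.
exists Y; split=> //.
  by apply: outer_factor_size YE _; rewrite Y0 // normr0.
move=> z; rewrite le_eqVlt => /orP [/eqP z1|/Y0 //].
apply/eqP => dY.
have /det0P [v v0 vY] : \det (ev z Y)^T == 0.
  by rewrite det_tr det_map_mx /= /horner_eval dY.
have Yv : ev z Y *m v^T = 0.
  by apply: trmx_inj; rewrite trmx_mul trmxK vY trmx0.
have := (pos z z1).2 v^T; rewrite -YE // /qform -!mulmxA Yv !mulmx0 mxE ltxx.
by rewrite -trmx0 (inj_eq trmx_inj) v0 => /(_ isT).
Qed.

End OuterFactor.

(** * Gram matrices of the form *)

Section Gram.
Variable F : numClosedFieldType.
Variables (r s d n D : nat).
Variables (M : 'M[{poly F}]_(r, d)) (N : 'M[{poly F}]_(s, d)).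
Variable b : 'I_D -> 'cV[{poly F}]_d.

Definition ip (t : nat) (f g : 'cV[{poly F}]_t) : F :=
  \sum_i \sum_(k < n) (f i 0)`_k * ((g i 0)`_k)^*.

Definition comb (v : 'cV[F]_D) : 'cV[{poly F}]_d :=
  \sum_a (v a 0)%:P *: b a.

Definition gram : 'M[F]_D :=
  \matrix_(a, c) (ip (M *m b c) (M *m b a) - ip (N *m b c) (N *m b a)).

Lemma coef_mul_comb t (L : 'M[{poly F}]_(t, d)) v i k :
  ((L *m comb v) i 0)`_k = \sum_a v a 0 * ((L *m b a) i 0)`_k.
Proof.
rewrite /comb mulmx_sumr summxE coef_sum; apply: eq_bigr => a _.
by rewrite -scalemxAr scalemx_coef coefCM.
Qed.

Lemma nrm_comb t (L : 'M[{poly F}]_(t, d)) v :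
  nrm n (L *m comb v) =
  \sum_a \sum_c (v a 0)^* * v c 0 * ip (L *m b c) (L *m b a).
Proof.
transitivity (\sum_i \sum_(k < n) \sum_a \sum_c (v a 0)^* * v c 0 *
    (((L *m b c) i 0)`_k * (((L *m b a) i 0)`_k)^*)).
  apply: eq_bigr => i _; apply: eq_bigr => k _.
  rewrite normCK coef_mul_comb rmorph_sum mulr_sumr; apply: eq_bigr => a _.
  rewrite mulr_suml; apply: eq_bigr => c _; rewrite rmorphM /=; ring.
rewrite (eq_bigr _ (fun i _ => exchange_big _ _ _ _ _ _)) exchange_big /=.
apply: eq_bigr => a _.
rewrite (eq_bigr _ (fun i _ => exchange_big _ _ _ _ _ _)) exchange_big /=.
apply: eq_bigr => c _; rewrite mulr_sumr; apply: eq_bigr => i _.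
by rewrite mulr_sumr.
Qed.

Lemma qform_gram v : qform gram v = hform n M N (comb v).
Proof.
rewrite qformE /hform !nrm_comb -sumrB; apply: eq_bigr => a _.
by rewrite -sumrB; apply: eq_bigr => c _; rewrite mxE mulrBr.
Qed.

Lemma gram_herm : gram^t* = gram.
Proof.
apply/matrixP => a c; rewrite !mxE rmorphB.
have ipC t (f g : 'cV[{poly F}]_t) : (ip f g)^* = ip g f.
  rewrite rmorph_sum; apply: eq_bigr => i _.
  rewrite rmorph_sum; apply: eq_bigr => k _.
  by rewrite rmorphM /= conjCK mulrC.
by rewrite /= !ipC.
Qed.

End Gram.

(** * The Schur-Cohn form *)

Section SchurCohn.
Variable F : numClosedFieldType.
Hypothesis archF : forall x : F, exists n : nat, `|x| < n%:R.
Implicit Types f g C : {poly F}.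

(** The order is reversed so that the Gram matrix of the form in this basis is
    the Schur-Cohn matrix, whose row and column [a] belong to [w^a]. *)
Definition shift_basis (m : nat) (a : 'I_m) : 'cV[{poly F}]_1 :=
  ('X^(m.-1 - a))%:M.

Definition sform m f g C : F := hform m (f%:M : 'M_1) (g%:M : 'M_1) C%:M.

Lemma sformE m f g C : sform m f g C =
  \sum_(k < m) `|(f * C)`_k| ^+ 2 - \sum_(k < m) `|(g * C)`_k| ^+ 2.
Proof.
by rewrite /sform /hform /nrm -!scalar_mxM !big_ord1 !mxE eqxx !mulr1n.
Qed.

Lemma sformS m f g C : sform m.+1 f g C =
  sform m f g C + (`|(f * C)`_m| ^+ 2 - `|(g * C)`_m| ^+ 2).
Proof. by rewrite !sformE !big_ord_recr /= opprD addrACA. Qed.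

Definition cpoly m (v : 'cV[F]_m) : {poly F} :=
  \sum_(a < m) v a 0 *: 'X^(m.-1 - a).

Lemma comb_shift_basis m (v : 'cV[F]_m) :
  comb (@shift_basis m) v = (cpoly v)%:M.
Proof.
apply/matrixP => i j; rewrite !ord1 summxE !mxE eqxx mulr1n.
by apply: eq_bigr => a _; rewrite !mxE eqxx mulr1n mul_polyC.
Qed.

Lemma coef_cpoly m (x : 'cV[F]_m.+1) (j : 'I_m.+1) :
  (cpoly x)`_(m - j) = x j 0.
Proof.
have jm (i : 'I_m.+1) : (i <= m)%N := ltn_ord i.
rewrite coef_sum (bigD1 j) //= coefZ coefXn eqxx mulr1 big1 ?addr0 // => i ij.
rewrite coefZ coefXn; case: eqP => [E|_]; last by rewrite mulr0.
by case/eqP: ij; apply: val_inj => /=; rewrite -(subKn (jm i)) -E subKn.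
Qed.

Lemma isometric_scalar f g : (forall w, `|w| = 1 -> `|f.[w]| = `|g.[w]|) ->
  isometric (f%:M : 'M_1) (g%:M : 'M_1).
Proof.
move=> fg w w1 x; rewrite !big_ord1 !map_scalar_mx /= !mul_scalar_mx.
by rewrite !scalemx_coef !normrM /horner_eval fg.
Qed.

Lemma size_scalar_mx_le f n : (size f <= n)%N -> size_mx_le n (f%:M : 'M_1).
Proof. by move=> fn i j; rewrite !ord1 mxE eqxx mulr1n. Qed.

(** The form of order [m + 1] at [cpoly x] is computed in two ways: split off
    its top coefficient, or undo the shift. With [K] the Schur-Cohn kernel of
    [f] and [g], this is [|f|^2 - |g|^2 = (1 - |w|^2) K] read on linear
    functionals of the polynomials in [w]. *)
Lemma sform_exchange m f g (x : 'cV[F]_m.+1) :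
  (forall w, `|w| = 1 -> `|f.[w]| = `|g.[w]|) ->
  (size f <= m.+1)%N -> (size g <= m.+1)%N ->
  `|\sum_(j < m.+1) f`_j * x j 0| ^+ 2 +
    sform m f g (cpoly (\col_l x (lift ord0 l) 0)) =
  `|\sum_(j < m.+1) g`_j * x j 0| ^+ 2 +
    sform m f g (cpoly (\col_l x (lift ord_max l) 0)).
Proof.
move=> fg sf sg.
have low : cpoly x = x 0 0 *: 'X^m + cpoly (\col_l x (lift ord0 l) 0).
  rewrite /cpoly big_ord_recl /= subn0; congr (_ + _); apply: eq_bigr => l _.
  by rewrite mxE -[m.-1]subn1 -subnDA.
have shift : cpoly x = 'X * cpoly (\col_l x (lift ord_max l) 0)
                       + (x ord_max 0)%:P.
  rewrite /cpoly big_ord_recr /= subnn alg_polyC; congr (_ + _).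
  rewrite mulr_sumr; apply: eq_bigr => l _; rewrite mxE -scalerAr -exprS.
  have lm := ltn_ord l; have m0 := leq_ltn_trans (leq0n l) lm.
  congr (x _ 0 *: 'X^_); first by apply: val_inj; rewrite /= /bump leqNgt lm.
  by rewrite -subSn ?prednK // -ltnS prednK.
have E1 : sform m.+1 f g (cpoly x) =
    sform m f g (cpoly (\col_l x (lift ord_max l) 0)).
  rewrite {1}shift /sform; set C := cpoly _.
  have -> : (('X * C + (x ord_max 0)%:P)%:M : 'M_1) =
      'X *: C%:M + map_mx polyC (x ord_max 0)%:M.
    by apply/matrixP => i j; rewrite !ord1 !mxE eqxx !mulr1n.
  apply: hform_shift; first exact: isometric_scalar.
    exact: size_scalar_mx_le.
  exact: size_scalar_mx_le.
have top h : (h * cpoly x)`_m = \sum_(j < m.+1) h`_j * x j 0.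
  by rewrite coefM; apply: eq_bigr => j _; rewrite coef_cpoly.
have E2 : sform m f g (cpoly x) =
    sform m f g (cpoly (\col_l x (lift ord0 l) 0)).
  rewrite low !sformE; congr (_ - _); apply: eq_bigr => k _;
  by rewrite mulrDr coefD -scalerAr coefZ coefMXn ltn_ord mulr0 add0r.
by rewrite -E1 sformS E2 !top; ring.
Qed.

Lemma crev_scale_norm m f (c w : F) : (size f <= m.+1)%N -> `|c| = 1 ->
  `|w| = 1 -> `|(c *: crev m f).[w]| = `|f.[w]|.
Proof.
move=> sf c1 w1; rewrite hornerZ horner_crev_circle // !normrM c1 normrX w1.
by rewrite expr1n !mul1r norm_conjC.
Qed.

(** A polynomial without zeros in the closed disk has a positive definite
    Schur-Cohn form. Positivity is the general principle, with no zeros to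
    account for. On an isotropic vector the exchange formula allows to shift
    the vector, so the isotropic space contains an eigenvector
    [(mu^(m-1), ..., mu, 1)] of the shift, and [f] vanishes both at [1 / mu]
    and at the conjugate of [mu], one of which is in the closed disk. *)
Theorem schur_cohn_posdef m f (c : F) :
  (size f <= m.+1)%N -> (forall w, `|w| <= 1 -> f.[w] != 0) -> `|c| = 1 ->
  posdef (gram m (f%:M : 'M_1) ((c *: crev m f)%:M : 'M_1) (@shift_basis m)).
Proof.
move=> sf f0 c1; set g := c *: crev m f; set T := gram _ _ _ _.
have fg w : `|w| = 1 -> `|f.[w]| = `|g.[w]|.
  by move=> w1; rewrite /g crev_scale_norm.
have sg : (size g <= m.+1)%N.
  by rewrite (leq_trans (size_scale_leq _ _)) // size_crev.
have TE v : qform T v = sform m f g (cpoly v).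
  by rewrite qform_gram comb_shift_basis.
have T0 v : 0 <= qform T v.
  rewrite TE; apply: (hform_ge0 archF (isometric_scalar fg) f0).
  exact: mul_scalar_mx.
split=> [|v v0]; first exact: gram_herm.
rewrite lt0r T0 andbT; apply/negP => /eqP Tv.
have [||X [Y [XYE _]]] := @hermitian_split _ m m 0 T 1%:M 0 (gram_herm _ _ _ _).
- by move=> u; rewrite mul1mx => ->; rewrite /qform mulmx0 mxE.
- by move=> u _; apply: T0.
have XE u : (qform T u = 0) <-> (X *m u = 0).
  rewrite XYE big_ord0 subr0; split=> [H|->]; last first.
    by rewrite big1 // => i _; rewrite mxE normr0 expr0n.
  apply/colP => i; rewrite [RHS]mxE; apply/eqP; rewrite -normr_eq0 -sqrf_eq0.
  by rewrite (psumr_eq0P _ H) // => j _; rewrite exprn_ge0.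
have f00 : f`_0 != 0 by rewrite -horner_coef0 f0 // normr0.
(* E u is u preceded by the entry which makes the sum with the coefficients of
   f vanish, and S u is E u without its last entry *)
pose E : 'M[F]_(m.+1, m) := \matrix_(j, l)
  if unlift ord0 j is Some k then (k == l)%:R else - (f`_0)^-1 * f`_l.+1.
have E_lift (u : 'cV[F]_m) l : (E *m u) (lift ord0 l) 0 = u l 0.
  rewrite mxE (bigD1 l) //= mxE liftK eqxx mul1r big1 ?addr0 // => k kl.
  by rewrite mxE liftK eq_sym (negPf kl) mul0r.
have fE (u : 'cV[F]_m) : \sum_(j < m.+1) f`_j * (E *m u) j 0 = 0.
  have E0 : (E *m u) 0 0 = - (f`_0)^-1 * \sum_(l < m) f`_l.+1 * u l 0.
    rewrite mxE mulr_sumr; apply: eq_bigr => l _.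
    by rewrite mxE unlift_none mulrA.
  rewrite big_ord_recl E0 mulNr mulrN mulVKf // addrC.
  apply/eqP; rewrite subr_eq0; apply/eqP.
  by apply: eq_bigr => l _; rewrite E_lift.
pose S : 'M[F]_m := \matrix_(i, l) E (lift ord_max i) l.
have SE (u : 'cV[F]_m) i : (S *m u) i 0 = (E *m u) (lift ord_max i) 0.
  by rewrite !mxE; apply: eq_bigr => l _; rewrite mxE.
have step (u : 'cV[F]_m) : X *m u = 0 ->
    X *m (S *m u) = 0 /\ \sum_(j < m.+1) g`_j * (E *m u) j 0 = 0.
  move=> /(iffRL (XE u)); rewrite TE => Tu.
  have := sform_exchange (E *m u) fg sf sg.
  have -> : \col_l (E *m u) (lift ord0 l) 0 = u.
    by apply/colP => l; rewrite mxE E_lift.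
  have -> : \col_l (E *m u) (lift ord_max l) 0 = S *m u.
    by apply/colP => l; rewrite mxE SE.
  rewrite fE normr0 expr0n Tu addr0 -TE => /esym/eqP.
  rewrite paddr_eq0 ?exprn_ge0 // => /andP [g0 /eqP Su].
  split; first exact: (iffLR (XE _) Su).
  by apply/eqP; rewrite -normr_eq0 -sqrf_eq0.
have [y [mu [y0 Xy ymu]]] : exists (y : 'cV[F]_m) (mu : F),
    [/\ y != 0, X *m y = 0 & S *m y = mu *: y].
  pose V := row_base (kermx X^T).
  have VX u : (u <= kermx X^T)%MS = (X *m u^T == 0).
    by rewrite sub_kermx -(inj_eq trmx_inj) trmx_mul trmxK trmx0.
  have r0 : (0 < \rank (kermx X^T))%N.
    rewrite lt0n mxrank_eq0; apply: contra v0 => /eqP k0.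
    have : (v^T <= kermx X^T)%MS by rewrite VX trmxK; apply/eqP/(iffLR (XE v)).
    by rewrite k0 submx0 -trmx0 (inj_eq trmx_inj).
  have /submxP [B BE] : (V *m S^T <= V)%MS.
    rewrite eq_row_base; apply/row_subP => i; rewrite row_mul VX.
    rewrite trmx_mul trmxK; apply/eqP/(step _ _).1.
    by apply/eqP; rewrite -VX -(eq_row_base (kermx X^T)) row_sub.
  have [mu /eigenvalueP [u uB u0]] := eigenvalue_closed B r0.
  exists (u *m V)^T, mu; split.
  - rewrite -trmx0 (inj_eq trmx_inj) mulmx_free_eq0 // row_base_free //.
  - by apply/eqP; rewrite -VX mulmx_sub // eq_row_base.
  - by rewrite -[S]trmxK -trmx_mul -mulmxA BE mulmxA uB -scalemxAl linearZ.
have [_ gy] := step y Xy; have fy := fE y; set x := E *m y in gy fy.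
have xE k (j : 'I_m.+1) : (m - j)%N = k -> x j 0 = mu ^+ k * x ord_max 0.
  elim: k j => [|k IH] j mj.
    rewrite expr0 mul1r; congr (x _ 0); apply: val_inj; apply/eqP => /=.
    by rewrite eqn_leq -ltnS ltn_ord -subn_eq0 mj.
  have jm : (j < m)%N by rewrite -subn_gt0 mj.
  have -> : j = lift ord_max (Ordinal jm).
    by apply: val_inj; rewrite /= /bump leqNgt jm.
  rewrite -SE ymu scalemx_coef -E_lift -/x exprS -mulrA; congr (_ * _).
  by apply: IH; rewrite /= /bump add1n subnS mj.
have x0 : x ord_max 0 != 0.
  apply: contra y0 => /eqP x0; apply/eqP/colP => l.
  by rewrite -E_lift -/x (xE _ _ erefl) x0 mulr0 mxE.
have root_g : f.[mu^*] = 0.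
  apply/eqP; rewrite -conjC_eq0; apply/eqP.
  apply: (mulIf x0); rewrite mul0r; have c0 : c != 0.
    by rewrite -normr_eq0 c1 oner_eq0.
  apply: (mulfI c0); rewrite mulr0 -[RHS]gy (horner_coef_wide _ sf).
  rewrite rmorph_sum /= mulr_suml mulr_sumr (reindex_inj rev_ord_inj).
  apply: eq_bigr => j _; rewrite (xE _ j erefl) coefZ coef_poly ltn_ord /=.
  by rewrite subSS rmorphM rmorphXn /= conjCK !mulrA.
have mu1 : 1 < `|mu|.
  rewrite real_ltNge ?real1 ?normr_real //; apply/negP; rewrite -norm_conjC.
  by move=> /f0; rewrite root_g eqxx.
have mu0 : mu != 0 by rewrite -normr_gt0 (lt_trans ltr01).
have : f.[mu^-1] = 0.
  apply: (mulIf x0); rewrite mul0r; apply: (mulfI (expf_neq0 m mu0)).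
  rewrite mulr0 -[RHS]fy (horner_coef_wide _ sf) mulr_suml mulr_sumr.
  apply: eq_bigr => j _; have jm : (j <= m)%N := ltn_ord j.
  by rewrite (xE _ j erefl) expfB_cond ?(negPf mu0) // exprVn; ring.
by apply/eqP/f0; rewrite normfV invf_le1 ?ltW // normr_gt0.
Qed.

End SchurCohn.

(** * Zeros inside and outside the disk *)

Section DiskSplit.
Variable F : numClosedFieldType.

Lemma size_prod_linear (s : seq F) (P : pred F) (g : F -> {poly F}) :
  (forall a, (size (g a) <= 2)%N) ->
  (size (\prod_(a <- s | P a) g a)%R <= (count P s).+1)%N.
Proof.
move=> sg; elim: s => [|a s IH] /=; first by rewrite big_nil size_poly1.
rewrite big_cons; case: (P a) => //=.
apply: (leq_trans (size_polyMleq _ _)).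
by rewrite -subn1 leq_subLR (leq_trans (leq_add (sg a) IH)) // add1n.
Qed.

Lemma crev_prod n (f : {poly F}) (s : seq F) :
  f = lead_coef f *: \prod_(a <- s) ('X - a%:P) -> (size f <= n.+1)%N ->
  (size s <= n)%N ->
  crev n f =
    ((lead_coef f)^* *: 'X^(n - size s)) * \prod_(a <- s) (1 - a^* *: 'X).
Proof.
move=> fE sf sn; apply: poly_circle_eq => z z1.
rewrite horner_crev_circle // {1}fE !hornerM !hornerZ hornerXn rmorphM /=.
have prodE (t : seq F) : (\prod_(a <- t) (1 - a^* *: 'X)).[z] =
    z ^+ size t * ((\prod_(a <- t) ('X - a%:P)).[z])^*.
  elim: t => [|a t IH]; first by rewrite !big_nil !hornerC expr0 rmorph1 mul1r.
  rewrite !big_cons !hornerM IH rmorphM /= exprS mulrACA; congr (_ * _).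
  rewrite !hornerE rmorphB /= (conj_circle z1) mulrBr.
  by rewrite divff ?circle_neq0 // [z * _]mulrC.
by rewrite prodE -{1}(subnK sn) exprD; ring.
Qed.

(** The zeros of the reflection are the [1 / conj(a)] for the zeros [a] of
    [f], and [n - deg f] zeros at the origin. *)
Lemma disk_split n (f : {poly F}) :
  (forall z, `|z| = 1 -> f.[z] != 0) -> (size f <= n.+1)%N ->
  (exists b c, [/\ f = b * c, (size b <= (nb_zeros_disk f).+1)%N &
                   forall z, `|z| <= 1 -> c.[z] != 0]) /\
  (exists b c, [/\ crev n f = b * c, (size b <= (n - nb_zeros_disk f).+1)%N &
                   forall z, `|z| <= 1 -> c.[z] != 0]).
Proof.
move=> f0 sf; rewrite /nb_zeros_disk; case: closed_field_poly_normal => s /= fE.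
have lc0 : lead_coef f != 0.
  rewrite lead_coef_eq0; apply/eqP => f00; have := f0 1 (normr1 _).
  by rewrite f00 horner0 eqxx.
have sn : (size s <= n)%N.
  by move: sf; rewrite {1}fE size_scale // size_prod_XsubC ltnS.
have s1 a : a \in s -> `|a| != 1.
  move=> sa; apply/eqP => /f0; rewrite fE hornerZ mulf_eq0 negb_or => /andP [_].
  by rewrite -[_.[_] == 0]/(root _ _) root_prod_XsubC sa.
set inD := fun a : F => `|a| < 1.
have cP : (count inD s + count (predC inD) s)%N = size s := count_predC _ _.
split.
  exists (\prod_(a <- s | inD a) ('X - a%:P)).
  exists (lead_coef f *: \prod_(a <- s | ~~ inD a) ('X - a%:P)); split.
  - by rewrite {1}fE (bigID inD) /= scalerAr.
  - by apply: size_prod_linear => a; rewrite size_XsubC.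
  move=> z z1; rewrite hornerZ mulf_neq0 // horner_prod prodf_seq_neq0.
  apply/allP => a sa; apply/implyP => aD; rewrite hornerXsubC subr_eq0.
  apply/eqP => za; move: aD (s1 a sa); rewrite /inD -za.
  by rewrite lt_neqAle z1 andbT negbK => ->.
exists ('X^(n - size s) * \prod_(a <- s | ~~ inD a) (1 - a^* *: 'X)).
exists ((lead_coef f)^* *: \prod_(a <- s | inD a) (1 - a^* *: 'X)); split.
- rewrite (crev_prod fE) // (bigID inD) /= -scalerAl -scalerAr; congr (_ *: _).
  by rewrite -mulrA; congr (_ * _); rewrite mulrC.
- apply: leq_trans (size_polyMleq _ _) _; rewrite size_polyXn addSn /=.
  apply: leq_trans (_ : (n - size s + (count (predC inD) s).+1 <= _)%N).
    rewrite leq_add2l; apply: size_prod_linear => a.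
    rewrite (leq_trans (size_polyD _ _)) // size_polyN geq_max size_poly1 /=.
    by rewrite (leq_trans (size_scale_leq _ _)) // size_polyX.
  rewrite addnS ltnS -cP subnDA subnK // leq_subRL.
    by rewrite cP.
  by rewrite (leq_trans _ sn) // -cP leq_addr.
move=> z z1; rewrite hornerZ mulf_neq0 ?conjC_eq0 // horner_prod prodf_seq_neq0.
apply/allP => a sa; apply/implyP => aD; rewrite !hornerE subr_eq0.
apply/eqP => /(congr1 (fun x => `|x|)); rewrite normr1 normrM norm_conjC => E.
have : `|a| * `|z| < 1.
  apply: le_lt_trans (_ : `|a| < 1) => //.
  by rewrite ler_piMr.
by rewrite -E ltxx.
Qed.

End DiskSplit.

(** * Bordered matrices *)

Section Bordered.
Variables (R : comNzRingType) (m : nat).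
Implicit Types (h : 'I_m.+1) (p : 'I_m.+1 -> R) (A : 'M[R]_m)
  (y : 'cV[R]_m.+1).

(** The zero column stands first ([h = ord0]) when the polynomials in [w] of
    the lower rows are multiplied by [w], and last ([h = ord_max]) when they
    are not. *)
Definition bordered h p A : 'M[R]_m.+1 := \matrix_(i, j)
  if unlift ord0 i is Some k then
    if unlift h j is Some l then A k l else 0
  else p j.

Definition drop_entry h (y : 'cV[R]_m.+1) : 'cV[R]_m := \col_l y (lift h l) 0.

Lemma bordered_mul0 h p A y :
  (bordered h p A *m y) 0 0 = \sum_j p j * y j 0.
Proof. by rewrite mxE; apply: eq_bigr => j _; rewrite mxE unlift_none. Qed.

Lemma bordered_mul_lift h p A y k :
  (bordered h p A *m y) (lift ord0 k) 0 = (A *m drop_entry h y) k 0.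
Proof.
rewrite mxE (bigD1_ord h) //= mxE liftK unlift_none mul0r add0r mxE.
by apply: eq_bigr => l _; rewrite !mxE !liftK.
Qed.

(** Cramer's rule: [\det A * p h] times the entry [h] of the solution [y] of
    [bordered h p A *m y = t] is [bordered_residue h p A *m t]. *)
Definition bordered_residue h p A : 'rV[R]_m.+1 := \row_j
  if unlift ord0 j is Some k then - \sum_l p (lift h l) * \adj A l k
  else \det A.

(** Solving by Cramer's rule for the entries other than [h] leaves one
    divisibility condition for the entry [h]. *)
Lemma bordered_solve h p A (b c f : R) (t : 'cV[R]_m.+1) :
  p h = b * c -> (bordered_residue h p A *m t) 0 0 = b * f ->
  exists y, bordered h p A *m y = (\det A * c) *: t.
Proof.
move=> pE; set x := \adj A *m drop_entry ord0 t.
have -> : (bordered_residue h p A *m t) 0 0 =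
    \det A * t 0 0 - \sum_l p (lift h l) * x l 0.
  rewrite mxE big_ord_recl mxE unlift_none; congr (_ + _).
  under eq_bigr do rewrite mxE liftK mulNr mulr_suml.
  rewrite sumrN exchange_big; congr (- _); apply: eq_bigr => l _.
  rewrite mxE mulr_sumr; apply: eq_bigr => k _.
  by rewrite [drop_entry _ _ _ _]mxE mulrA.
move=> tE; exists (\col_j if unlift h j is Some l then c * x l 0 else f).
have yE : drop_entry h
    (\col_j if unlift h j is Some l then c * x l 0 else f) = c *: x.
  by apply/colP => l; rewrite scalemx_coef mxE mxE liftK.
apply/colP => i; rewrite scalemx_coef.
case: (unliftP ord0 i) => [k ->|->].
  rewrite bordered_mul_lift yE -scalemxAr mulmxA mul_mx_adj mul_scalar_mx.
  by rewrite !scalemx_coef mulrA [c * _]mulrC [drop_entry _ _ _ _]mxE.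
rewrite bordered_mul0 (bigD1_ord h) //= mxE unlift_none pE.
under eq_bigr do rewrite mxE liftK mulrCA.
rewrite -mulr_sumr mulrAC -tE; ring.
Qed.

End Bordered.

Lemma map_bordered (R S : comNzRingType) (f : {rmorphism R -> S}) m
    (h : 'I_m.+1) (p : 'I_m.+1 -> R) (A : 'M[R]_m) :
  map_mx f (bordered h p A) = bordered h (f \o p) (map_mx f A).
Proof.
apply/matrixP => i j; rewrite !mxE; case: unliftP => //= k _.
by case: unliftP => [l _|_]; rewrite ?mxE ?rmorph0.
Qed.

Section NegativeSquares.
Variable F : numClosedFieldType.
Hypothesis archF : forall x : F, exists n : nat, `|x| < n%:R.

(** The linear conditions are that [b], which carries the zeros of the
    determinant in the disk, divides the residue of the part of [M C] beyond
    the truncation. *)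
Lemma bordered_nonneg m s n D nu (h : 'I_m.+1) (p : 'I_m.+1 -> {poly F})
    (A : 'M[{poly F}]_m) (N : 'M[{poly F}]_(s, m.+1))
    (e : 'I_D -> 'cV[{poly F}]_m.+1) (b c : {poly F}) :
  isometric (bordered h p A) N ->
  p h = b * c -> p h != 0 -> (size b <= nu.+1)%N ->
  (forall z, `|z| <= 1 -> c.[z] != 0) ->
  (forall z, `|z| <= 1 -> (\det A).[z] != 0) ->
  exists Phi : 'M[F]_(nu, D), forall v, Phi *m v = 0 ->
    0 <= hform n (bordered h p A) N (comb e v).
Proof.
move=> iso pE p0 sb c0 A0; set M := bordered h p A.
have b0 : b != 0 by apply: contraNneq p0 => b0; rewrite pE b0 mul0r.
pose t (C : 'cV[{poly F}]_m.+1) := map_mx (drop_poly n) (M *m C).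
have tE v : t (comb e v) = \sum_a (v a 0)%:P *: t (e a).
  apply/colP => i; rewrite mxE summxE; apply/polyP => k.
  rewrite coef_drop_poly coef_mul_comb coef_sum; apply: eq_bigr => a _.
  by rewrite scalemx_coef coefCM /t [in RHS]mxE coef_drop_poly.
pose res C := (bordered_residue h p A *m t C) 0 0.
have resE v : res (comb e v) = \sum_a v a 0 *: res (e a).
  rewrite /res tE mulmx_sumr summxE; apply: eq_bigr => a _.
  by rewrite -scalemxAr scalemx_coef mul_polyC.
exists (\matrix_(k, a) (res (e a) %% b)`_k) => v Phiv.
have : res (comb e v) %% b = 0.
  apply/polyP => k; rewrite coef0.
  have [nuk|knu] := leqP nu k.
    rewrite nth_default // (leq_trans _ nuk) // -ltnS.
    by rewrite (leq_trans _ sb) // ltn_modp.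
  have := congr1 (fun X : 'cV_nu => X (Ordinal knu) 0) Phiv.
  rewrite /= !mxE => Phiv_k; rewrite -[RHS]Phiv_k.
  have -> : res (comb e v) %% b = \sum_a (v a 0 *: res (e a)) %% b.
    by rewrite resE; apply: (big_morph (fun x => x %% b) (modpD b) (mod0p b)).
  by rewrite coef_sum; apply: eq_bigr => a _; rewrite mxE modpZl coefZ mulrC.
move=> /eqP /(divpK) /esym; rewrite mulrC => bres.
have [y yE] := bordered_solve pE bres.
apply: (hform_ge0 archF iso _ yE) => z z1.
by rewrite hornerM mulf_neq0 ?A0 ?c0.
Qed.

End NegativeSquares.

(** * Polynomials without zeros on the circle times the closed disk *)

Section Strict.
Variable F : numClosedFieldType.
Hypothesis archF : forall x : F, exists n : nat, `|x| < n%:R.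
Variables n m : nat.
Implicit Types (P Q : {poly {poly F}}) (z w : F).

Local Notation at_z z P := (map_poly (horner_eval z) P).

(** The reflection of a polynomial in [w] with coefficients in [C[z]]. *)
Definition crev2 (P : {poly {poly F}}) : {poly {poly F}} :=
  \poly_(j < m.+1) crev n P`_(m - j).

Definition bisize_le (P : {poly {poly F}}) : Prop :=
  (size P <= m.+1)%N /\ forall j, (size (P`_j)%R <= n.+1)%N.

Lemma size_at_z z P : (size P <= m.+1)%N -> (size (at_z z P) <= m.+1)%N.
Proof. exact/leq_trans/size_poly. Qed.

Lemma coef_at_z z P k : (at_z z P)`_k = (P`_k).[z].
Proof. by rewrite coef_map. Qed.

Lemma bisize_crev2 P : bisize_le (crev2 P).
Proof.
split=> [|j]; first exact: size_poly.
by rewrite coef_poly; case: ifP; rewrite ?size_crev ?size_poly0.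
Qed.

Lemma crev2_circle P z : bisize_le P -> `|z| = 1 ->
  at_z z (crev2 P) = z ^+ n *: crev m (at_z z P).
Proof.
move=> [_ sP] z1; apply/polyP => j.
rewrite coefZ coef_at_z coef_poly [in RHS]coef_poly.
case: ifP => _; last by rewrite horner0 mulr0.
by rewrite horner_crev_circle // coef_at_z.
Qed.

Definition sc_entry (P : {poly {poly F}}) (a : 'I_m) (k : nat) : {poly F} :=
  (P * 'X^(m.-1 - a))`_k.

Lemma size_sc_entry P a k : bisize_le P -> (size (sc_entry P a k) <= n.+1)%N.
Proof.
by move=> [_ sP]; rewrite /sc_entry coefMXn; case: ifP; rewrite ?size_poly0.
Qed.

Lemma horner_sc_entry P a k z :
  (sc_entry P a k).[z] = (at_z z P * 'X^(m.-1 - a))`_k.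
Proof.
by rewrite /sc_entry !coefMXn coef_at_z; case: ifP; rewrite ?horner0.
Qed.

(** The Schur-Cohn matrix of [P(z, .)], multiplied by [z^n] to make its
    entries polynomials: [crev n] of an entry stands for [z^n] times its
    conjugate. *)
Definition sc_matrix (P : {poly {poly F}}) : 'M[{poly F}]_m :=
  \matrix_(a, c) \sum_(k < m)
    (sc_entry P c k * crev n (sc_entry P a k)
     - sc_entry (crev2 P) c k * crev n (sc_entry (crev2 P) a k)).

Lemma gram_scalarE (f g : {poly F}) (a c : 'I_m) :
  gram m (f%:M : 'M_1) (g%:M : 'M_1) (@shift_basis F m) a c =
  \sum_(k < m) ((f * 'X^(m.-1 - c))`_k * ((f * 'X^(m.-1 - a))`_k)^*
                - (g * 'X^(m.-1 - c))`_k * ((g * 'X^(m.-1 - a))`_k)^*).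
Proof.
rewrite mxE /ip !big_ord1 -sumrB; apply: eq_bigr => k _.
by rewrite /shift_basis -!scalar_mxM !mxE eqxx !mulr1n.
Qed.

Lemma sc_matrixE P z : bisize_le P -> `|z| = 1 ->
  z ^- n *: ev z (sc_matrix P) =
  gram m ((at_z z P)%:M : 'M_1) ((at_z z (crev2 P))%:M : 'M_1)
    (@shift_basis F m).
Proof.
move=> sP z1; apply/matrixP => a c.
rewrite gram_scalarE; under [RHS]eq_bigr do rewrite -!horner_sc_entry.
rewrite !mxE /horner_eval horner_sum mulr_sumr.
apply: eq_bigr => k _; rewrite hornerD hornerN !hornerM.
have z0 : z ^+ n != 0 by rewrite expf_neq0 // circle_neq0.
have sQ := bisize_crev2 P.
rewrite !horner_crev_circle ?size_sc_entry //.
have zz x y : z ^- n * (x * (z ^+ n * y)) = x * y by rewrite mulrCA mulKf.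
by rewrite mulrBr !zz.
Qed.

Lemma sc_posdef P : bisize_le P ->
  (forall z w, `|z| = 1 -> `|w| <= 1 -> (at_z z P).[w] != 0) ->
  forall z, `|z| = 1 -> posdef (z ^- n *: ev z (sc_matrix P)).
Proof.
move=> sP P0 z z1; rewrite sc_matrixE // crev2_circle //.
apply: schur_cohn_posdef => // [|w w1|].
- by apply: size_at_z; case: sP.
- exact: P0.
- by rewrite normrX z1 expr1n.
Qed.

Lemma sum_norm_qform r (X : 'M[F]_(r, m)) (v : 'cV[F]_m) :
  \sum_k `|(X *m v) k 0| ^+ 2 = qform (X^t* *m X) v.
Proof.
rewrite /qform !mulmxA -adjmx_mul -mulmxA mxE.
by apply: eq_bigr => k _; rewrite normCK mulrC !mxE.
Qed.

Section Factor.
Variables (P : {poly {poly F}}) (A : 'M[{poly F}]_m).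
Hypothesis sP : bisize_le P.
Hypothesis sA : size_mx_le n.+1 A.
Hypothesis AE : forall z, `|z| = 1 ->
  (ev z A)^t* *m ev z A = z ^- n *: ev z (sc_matrix P).

Let M := bordered ord0 (fun j : 'I_m.+1 => P`_j) A.
Let N := bordered ord_max (fun j : 'I_m.+1 => (crev2 P)`_j) A.

Lemma sum_norm_bordered (Q : {poly {poly F}}) h z (x : 'cV[F]_m.+1) :
  \sum_i `|(ev z (bordered h (fun j : 'I_m.+1 => Q`_j) A) *m x) i 0| ^+ 2 =
  `|\sum_(j < m.+1) (at_z z Q)`_j * x j 0| ^+ 2 +
  \sum_k `|(ev z A *m drop_entry h x) k 0| ^+ 2.
Proof.
rewrite map_bordered big_ord_recl bordered_mul0; congr (`|_| ^+ 2 + _).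
  by apply: eq_bigr => j _; rewrite coef_at_z.
by apply: eq_bigr => k _; rewrite bordered_mul_lift.
Qed.

Lemma bordered_isometric : isometric M N.
Proof.
move=> z z1 x; rewrite !sum_norm_bordered !sum_norm_qform AE // sc_matrixE //.
rewrite !qform_gram !comb_shift_basis; apply: sform_exchange.
- move=> w w1; rewrite crev2_circle // crev_scale_norm ?normrX ?z1 ?expr1n //.
  by apply: size_at_z; case: sP.
- by apply: size_at_z; case: sP.
- by apply: size_at_z; case: (bisize_crev2 P).
Qed.

Lemma size_bordered h (Q : {poly {poly F}}) : bisize_le Q ->
  size_mx_le n.+1 (bordered h (fun j : 'I_m.+1 => Q`_j) A).
Proof.
move=> [_ sQ] i j; rewrite mxE; case: unliftP => // k _.
by case: unliftP => [l _|_]; rewrite ?size_poly0.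
Qed.

(** For the vector [e] of the powers of [w], the norm of [M(z) e] is made of
    [P(z, w)] and of [w] times the entries of [A(z)] applied to the powers of
    [w], and the same without the factor [w] for [N]. *)
Lemma bordered_identity z w : let e : 'cV[F]_m.+1 := \col_j w ^+ j in
  `|(at_z z P).[w]| ^+ 2 - `|(at_z z (crev2 P)).[w]| ^+ 2 =
  (1 - `|w| ^+ 2) * (\sum_k `|\sum_l (A k l).[z] * w ^+ l| ^+ 2) +
  (1 - `|z| ^+ 2) * hform n M N (powsum z n *: map_mx polyC e).
Proof.
move=> e; rewrite (hform_powsum z e bordered_isometric); first last.
- exact/size_bordered/bisize_crev2.
- exact: size_bordered.
rewrite !sum_norm_bordered.
have top Q : bisize_le Q ->
    \sum_(j < m.+1) (at_z z Q)`_j * e j 0 = (at_z z Q).[w].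
  move=> [sQ _]; rewrite (horner_coef_wide w (size_at_z z sQ)).
  by apply: eq_bigr => j _; rewrite mxE.
rewrite (top _ sP) (top _ (bisize_crev2 P)).
have e0 : drop_entry ord0 e = w *: \col_l w ^+ l.
  by apply/colP => l; rewrite !mxE exprS.
have emax : drop_entry ord_max e = \col_l w ^+ l.
  by apply/colP => l; rewrite !mxE /= /bump leqNgt ltn_ord.
have body k : (ev z A *m \col_l w ^+ l) k 0 = \sum_l (A k l).[z] * w ^+ l.
  by rewrite mxE; apply: eq_bigr => l _; rewrite !mxE.
rewrite e0 emax.
under [X in _ = _ + (_ + X - _)]eq_bigr => k _ do
  rewrite -scalemxAr scalemx_coef normrM exprMn body.
under [X in _ = _ + (_ - (_ + X))]eq_bigr => k _ do rewrite body.
by rewrite -mulr_sumr; ring.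
Qed.

End Factor.
End Strict.

Section StrictDecomposition.
Variable F : numClosedFieldType.
Hypothesis archF : forall x : F, exists n : nat, `|x| < n%:R.
Variables n m : nat.
Implicit Types (P Q : {poly {poly F}}) (z w : F).

Local Notation at_z z P := (map_poly (horner_eval z) P).

(** Parseval for a diagonal entry of [A* A], which is a sum of [|f|^2 - |g|^2]
    with [f] ranging over coefficients of [P]. *)
Lemma factor_coef_bound P (A : 'M[{poly F}]_m) (beta : F) j l i :
  bisize_le n m P -> size_mx_le n.+1 A ->
  (forall z, `|z| = 1 ->
    (ev z A)^t* *m ev z A = z ^- n *: ev z (sc_matrix n m P)) ->
  (forall j i, `|P`_j`_i| <= beta) ->
  `|(A j l)`_i| ^+ 2 <= (m * n.+1)%:R * beta ^+ 2.
Proof.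
move=> sP sA AE Pbeta; have beta0 : 0 <= beta by apply: le_trans (Pbeta 0 0)%N.
pose f (s : 'I_m + 'I_m) := match s with
  inl j => A j l | inr k => sc_entry (crev2 n m P) l k end.
have := @parseval F _ _ n.+1 f (fun k : 'I_m => sc_entry P l k).
rewrite !big_sumType /= => H.
have [ni|ni] := leqP n.+1 i.
  rewrite nth_default ?(leq_trans (sA j l)) // normr0 expr0n.
  by rewrite mulr_ge0 // exprn_ge0.
have sum_ge0 (I : finType) (g : I -> {poly F}) :
    0 <= \sum_i \sum_(k < n.+1) `|(g i)`_k| ^+ 2.
  by apply: sumr_ge0 => s _; apply: sumr_ge0 => k _; rewrite exprn_ge0.
apply: le_trans (_ : \sum_j \sum_(k < n.+1) `|(A j l)`_k| ^+ 2 <= _).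
  rewrite (bigD1 j) //= (bigD1 (Ordinal ni)) //= -addrA lerDl addr_ge0 //.
    by apply: sumr_ge0 => k _; rewrite exprn_ge0.
  by apply: sumr_ge0 => s _; apply: sumr_ge0 => k _; rewrite exprn_ge0.
apply: le_trans
  (_ : \sum_(k < m) \sum_(i < n.+1) `|(sc_entry P l k)`_i| ^+ 2 <= _).
  rewrite -H ?lerDl ?sum_ge0 // => [[j'|k]|k|z z1]; rewrite ?size_sc_entry //.
  - exact: sA.
  - exact: bisize_crev2.
  - have := congr1 (fun X : 'M_m => X l l) (AE z z1).
    rewrite /= gram_entry sc_matrixE // gram_scalarE sumrB => E.
    rewrite big_sumType /=; under eq_bigr do rewrite normCK; rewrite E.
    under [X in _ + X = _]eq_bigr do rewrite horner_sc_entry normCK.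
    by rewrite subrK; apply: eq_bigr => k _; rewrite horner_sc_entry normCK.
apply: le_trans (_ : \sum_(k < m) \sum_(i < n.+1) beta ^+ 2 <= _).
  apply: ler_sum => k _; apply: ler_sum => i' _.
  rewrite ler_pXn2r ?nnegrE // /sc_entry coefMXn.
  by case: ifP; rewrite ?coef0 ?normr0.
by rewrite !sumr_const !card_ord -mulrnA mulr_natl mulnC.
Qed.

Lemma crev2_coef_bound P (beta : F) : (forall j i, `|P`_j`_i| <= beta) ->
  forall j i, `|(crev2 n m P)`_j`_i| <= beta.
Proof.
move=> Pbeta j i; have beta0 : 0 <= beta by apply: le_trans (Pbeta 0 0)%N.
rewrite coef_poly; case: ifP => _; last by rewrite coef0 normr0.
rewrite coef_poly; case: ifP => _; last by rewrite normr0.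
by rewrite norm_conjC.
Qed.

Lemma ip_bound r (f g : 'cV[{poly F}]_r) (K : F) :
  (forall i k, `|(f i 0)`_k| ^+ 2 <= K) ->
  (forall i k, `|(g i 0)`_k| ^+ 2 <= K) ->
  `|ip n f g| <= (r * n)%:R * K.
Proof.
move=> fK gK; apply: le_trans (ler_norm_sum _ _ _) _.
apply: le_trans (_ : \sum_(i < r) \sum_(k < n) K <= _); last first.
  by rewrite !sumr_const !card_ord -mulrnA mulr_natl mulnC.
apply: ler_sum => i _; apply: le_trans (ler_norm_sum _ _ _) _.
apply: ler_sum => k _; rewrite normrM norm_conjC.
set x := `|_|; set y := `|_|.
rewrite -(@ler_pM2l _ 2) // -subr_ge0.
have -> : 2 * K - 2 * (x * y) =
    (K - x ^+ 2) + (K - y ^+ 2) + (x - y) ^+ 2 by ring.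
have xy : 0 <= (x - y) ^+ 2.
  by rewrite real_exprn_even_ge0 // rpredB // normr_real.
by rewrite addr_ge0 // addr_ge0 // subr_ge0 ?fK ?gK.
Qed.

Local Notation index := ('I_n * 'I_m.+1)%type.
Definition ker_basis (a : 'I_#|{: index}|) : 'cV[{poly F}]_m.+1 :=
  'X^(n.-1 - (enum_val a).1) *: delta_mx (enum_val a).2 0.

Definition monomials z w : 'cV[F]_#|{: index}| :=
  \col_(a < #|{: index}|) (z ^+ (enum_val a).1 * w ^+ (enum_val a).2).

Lemma comb_ker_basis z w :
  comb ker_basis (monomials z w) =
  powsum z n *: map_mx polyC (\col_(j < m.+1) w ^+ j).
Proof.
apply/colP => j; rewrite scalemx_coef !mxE summxE.
rewrite (reindex (@enum_rank _)) /=; last first.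
  by exists enum_val => x _; rewrite ?enum_rankK ?enum_valK.
pose G (i : 'I_n) (k : 'I_m.+1) :=
  ((monomials z w (enum_rank (i, k)) 0)%:P *: ker_basis (enum_rank (i, k))) j 0.
transitivity (\sum_(p : index) G p.1 p.2).
  by apply: eq_bigr => -[i k] _.
rewrite -(pair_bigA _ G).
rewrite /= /powsum poly_def mulr_suml (reindex_inj rev_ord_inj) /=.
apply: eq_bigr => i _; rewrite (bigD1 j) //= [X in _ + X]big1 ?addr0.
  rewrite /G /ker_basis !mxE enum_rankK /= eqxx mulr1.
  have ni : (i < n)%N := ltn_ord i; have n0 := leq_ltn_trans (leq0n i) ni.
  have -> : (n - i.+1 = n.-1 - i)%N by rewrite -[n.-1]subn1 -subnDA.
  rewrite subKn; last by rewrite -ltnS prednK.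
  by rewrite polyCM mulrAC mul_polyC.
move=> k kj; rewrite /G /ker_basis !mxE enum_rankK /= eq_sym (negPf kj).
by rewrite !mulr0.
Qed.

Definition ev2 (a : 'I_n.+1 -> 'I_m.+1 -> F) z w : F :=
  \sum_i \sum_k a i k * (z ^+ i * w ^+ k).

(** The squares come from diagonalizing [hform] for the two bordered matrices
    built on an outer factor of the Schur-Cohn matrix; the corner entries which
    bound its inertia are [P(z, 0)] and its reflection. The bound [K] is what
    makes the passage to the limit possible when zeros approach [|w| = 1]. *)
Theorem strict_decomposition (beta : F) : exists K : F, forall P,
  bisize_le n m P -> (forall j i, `|P`_j`_i| <= beta) ->
  (forall z w, `|z| = 1 -> `|w| <= 1 -> (at_z z P).[w] != 0) ->
  let n2 := nb_zeros_disk P`_0 in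
  exists (a : 'I_m -> 'I_n.+1 -> 'I_m.+1 -> F)
         (b : 'I_(n - n2) -> 'I_n.+1 -> 'I_m.+1 -> F)
         (c : 'I_n2 -> 'I_n.+1 -> 'I_m.+1 -> F),
  (forall z w, `|(at_z z P).[w]| ^+ 2 - `|(at_z z (crev2 n m P)).[w]| ^+ 2 =
    (1 - `|w| ^+ 2) * (\sum_j `|ev2 (a j) z w| ^+ 2) +
    (1 - `|z| ^+ 2) * (\sum_j `|ev2 (b j) z w| ^+ 2
                       - \sum_j `|ev2 (c j) z w| ^+ 2)) /\
  [/\ forall j i k, `|a j i k| ^+ 2 <= K, forall j i k, `|b j i k| ^+ 2 <= K
    & forall j i k, `|c j i k| ^+ 2 <= K].
Proof.
pose K1 := (m * n.+1)%:R * beta ^+ 2 + beta ^+ 2.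
pose K2 := \sum_(a < #|{: index}|) \sum_(c < #|{: index}|)
  ((m.+1 * n)%:R * K1 + (m.+1 * n)%:R * K1).
exists (K1 + K2) => P sP Pbeta P0 n2.
have beta0 : 0 <= beta by apply: le_trans (Pbeta 0 0)%N.
have beta20 : 0 <= beta ^+ 2 by rewrite exprn_ge0.
have K1A : (m * n.+1)%:R * beta ^+ 2 <= K1 by rewrite lerDl.
have K1b : beta ^+ 2 <= K1 by rewrite lerDr mulr_ge0.
have K10 : 0 <= K1 by apply: le_trans K1b.
have K20 : 0 <= K2.
  apply: sumr_ge0 => a _; apply: sumr_ge0 => c _.
  by rewrite addr_ge0 // mulr_ge0.
have [A [sA AE A0]] := fejer_riesz (sc_posdef archF sP P0).
have iso := bordered_isometric sP AE.
set M := bordered ord0 _ A in iso; set N := bordered ord_max _ A in iso.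
have sQ := bisize_crev2 n m P.
pose H := gram n M N ker_basis.
have p00 z : `|z| = 1 -> (P`_0).[z] != 0.
  by move=> z1; rewrite -coef_at_z -horner_coef0 P0 // normr0 ler01.
have [[b1 [c1 [pE sb1 c10]]] [b2 [c2 [qE sb2 c20]]]] :=
  disk_split p00 (sP.2 0)%N.
have P00 : P`_0 != 0.
  by apply/eqP => P00; have := p00 1 (normr1 _); rewrite P00 horner0 eqxx.
have QmE : (crev2 n m P)`_m = crev n P`_0 by rewrite coef_poly ltnSn subnn.
have Qm0 : (crev2 n m P)`_m != 0.
  apply/eqP => Qm; have := horner_crev_circle (sP.2 0)%N (normr1 F).
  rewrite -QmE Qm horner0 expr1n mul1r => /esym/eqP.
  by rewrite conjC_eq0 (negPf (p00 1 (normr1 _))).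
have [Phi2 Phi2P] := bordered_nonneg archF n ker_basis iso pE P00 sb1 c10 A0.
have [Phi1 Phi1P] := bordered_nonneg archF n ker_basis (isometric_sym iso)
  (etrans QmE qE) Qm0 sb2 c20 A0.
have [v Phiv|v Phiv|X [Y [XYE [XK YK]]]] :=
  @hermitian_split _ _ _ _ H Phi1 Phi2 (gram_herm _ _ _ _).
- rewrite qform_gram -oppr_ge0 opprB; exact: Phi1P.
- rewrite qform_gram; exact: Phi2P.
have coefM h (Q : {poly {poly F}}) i j k : (forall j i, `|Q`_j`_i| <= beta) ->
    `|(bordered h (fun j : 'I_m.+1 => Q`_j) A i j)`_k| ^+ 2 <= K1.
  move=> Qbeta; rewrite mxE; case: unliftP => [i' _|_]; last first.
    by apply: le_trans K1b; rewrite ler_pXn2r ?nnegrE.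
  case: unliftP => [l _|_]; last by rewrite coef0 normr0 expr0n.
  exact: le_trans (factor_coef_bound _ _ _ sP sA AE Pbeta) K1A.
have basisM (L : 'M[{poly F}]_m.+1)
    (LK : forall i j k, `|(L i j)`_k| ^+ 2 <= K1) a i k :
    `|((L *m ker_basis a) i 0)`_k| ^+ 2 <= K1.
  rewrite -scalemxAr scalemx_coef coefXnM; case: ifP.
    by rewrite normr0 expr0n.
  rewrite mxE (bigD1 (enum_val a).2) //= !mxE !eqxx mulr1 big1 ?addr0 //.
  by move=> j ja; rewrite mxE (negPf ja) mulr0.
have HK : \sum_a \sum_c `|H a c| <= K2.
  apply: ler_sum => a _; apply: ler_sum => c _; rewrite mxE.
  apply: le_trans (ler_normB _ _) _.
  rewrite lerD // ip_bound // => i k; apply: basisM => i' j' k'; apply: coefM;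
  by [|exact: crev2_coef_bound].
pose ca (j : 'I_m) (i : 'I_n.+1) (k : 'I_m.+1) : F :=
  if unlift ord_max k is Some l then (A j l)`_i else 0.
pose cx nu (Z : 'M[F]_(nu, #|{: index}|)) (j : 'I_nu)
    (i : 'I_n.+1) (k : 'I_m.+1) :=
  if unlift ord_max i is Some i' then Z j (enum_rank (i', k)) else 0.
have caE j z w : ev2 (ca j) z w = \sum_l (A j l).[z] * w ^+ l.
  rewrite /ev2 exchange_big (bigD1_ord ord_max) //= [X in X + _]big1 ?add0r.
    apply: eq_bigr => l _; rewrite (horner_coef_wide z (sA j l)) mulr_suml.
    apply: eq_bigr => i _; rewrite /ca liftK mulrA; congr (_ * w ^+ _).
    by rewrite /= /bump leqNgt ltn_ord.
  by move=> i _; rewrite /ca unlift_none mul0r.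
have cxE nu (Z : 'M[F]_(nu, #|{: index}|)) j z w :
    ev2 (cx nu Z j) z w = (Z *m monomials z w) j 0.
  rewrite mxE (reindex (@enum_rank _)) /=; last first.
    by exists enum_val => x _; rewrite ?enum_rankK ?enum_valK.
  pose G (i : 'I_n) (k : 'I_m.+1) := Z j (enum_rank (i, k)) * (z ^+ i * w ^+ k).
  transitivity (\sum_(p : index) G p.1 p.2); last first.
    by apply: eq_bigr => -[i k] _; rewrite mxE enum_rankK.
  rewrite -(pair_bigA _ G) /ev2 (bigD1_ord ord_max) //= big1 ?add0r.
    apply: eq_bigr => i _; apply: eq_bigr => k _; rewrite /cx liftK /G.
    by congr (_ * (z ^+ _ * _)); rewrite /= /bump leqNgt ltn_ord.
  by move=> k _; rewrite /cx unlift_none mul0r.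
exists ca, (cx _ X), (cx _ Y); split; last first.
  have cxK nu (Z : 'M[F]_(nu, #|{: index}|)) j i k :
      (forall j b, `|Z j b| ^+ 2 <= \sum_a \sum_c `|H a c|) ->
      `|cx nu Z j i k| ^+ 2 <= K1 + K2.
    move=> ZK; rewrite /cx; case: unliftP => [i' _|_].
      by rewrite (le_trans (ZK _ _)) // (le_trans HK) // lerDr.
    by rewrite normr0 expr0n addr_ge0.
  split=> j i k; [|exact: cxK|exact: cxK].
  rewrite /ca; case: unliftP => [l _|_]; last by rewrite normr0 expr0n addr_ge0.
  rewrite (le_trans (factor_coef_bound _ _ _ sP sA AE Pbeta)) //.
  by rewrite (le_trans K1A) // lerDl.
move=> z w; rewrite (bordered_identity sP sA AE) -/M -/N.
rewrite -comb_ker_basis -qform_gram -/H XYE.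
congr (_ * _ + _ * (_ - _)).
- by apply: eq_bigr => j _; rewrite caE.
- by apply: eq_bigr => j _; rewrite cxE.
- by apply: eq_bigr => j _; rewrite cxE.
Qed.

End StrictDecomposition.

(** * Limits along an ultrafilter *)

Section UltraLimit.
Variable R : realType.
Import numFieldNormedType.Exports.
Local Open Scope classical_set_scope.
Local Notation F := R[i].

Definition free_ultra (U : set_system nat) : Prop :=
  UltraFilter U /\ (\oo `<=` U)%classic.

Lemma free_ultra_exists : exists U, free_ultra U.
Proof. exact: (@ultraFilterLemma nat \oo _). Qed.

Lemma ultra_bounded_cvg (U : set_system nat) (u : nat -> R) (B : R) :
  free_ultra U -> (forall k, `|u k| <= B) ->
  exists l : R, ((u k @[k --> U]) --> l)%classic.
Proof.
move=> [UU _] uB; have UP : ProperFilter U by apply: ultra_proper.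
have := @segment_compact R (- B) B.
rewrite compact_ultra => /(_ (u k @[k --> U])).
case.
- split=> [|G GP uG]; first exact: fmap_proper_filter.
  rewrite predeqE => A; split=> [GA|]; last exact: uG.
  have [//|UnA] := in_ultra_setVsetC (u @^-1` A) UU.
  have GnA : G (~` A) by apply: uG.
  by have /filter_ex [? []] : G (A `&` ~` A) by apply: filterI.
- apply: (@filterE _ U) => k /=; rewrite in_itv /= -ler_norml; exact: uB.
by move=> l [_ ul]; exists l.
Qed.

(** All bounded sequences converge along the same ultrafilter, so no
    subsequences have to be extracted. *)
Definition ulim (U : set_system nat) (u : nat -> F) (l : F) : Prop :=
  ((complex.Re (u k) @[k --> U]) --> complex.Re l)%classic /\
  ((complex.Im (u k) @[k --> U]) --> complex.Im l)%classic.

Section Rules.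
Variable U : set_system nat.
Hypothesis UF : free_ultra U.

Let UP : ProperFilter U. Proof. by apply: ultra_proper; case: UF. Qed.
Local Existing Instance UP.

Lemma ulim_cst c : ulim U (fun _ => c) c.
Proof. by split; apply: cvg_cst. Qed.

Lemma ulimD u v a b : ulim U u a -> ulim U v b ->
  ulim U (fun k => u k + v k) (a + b).
Proof.
move=> [ua ua'] [vb vb']; split.
- rewrite raddfD /=; under eq_fun do rewrite raddfD /=. exact: cvgD.
- rewrite raddfD /=; under eq_fun do rewrite raddfD /=. exact: cvgD.
Qed.

Lemma ulimM u v a b : ulim U u a -> ulim U v b ->
  ulim U (fun k => u k * v k) (a * b).
Proof.
have ReM (x y : F) :
    complex.Re (x * y) =
    complex.Re x * complex.Re y - complex.Im x * complex.Im y.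
  by case: x y => [? ?] [? ?].
have ImM (x y : F) :
    complex.Im (x * y) =
    complex.Re x * complex.Im y + complex.Im x * complex.Re y.
  by case: x y => [? ?] [? ?].
move=> [ua ua'] [vb vb']; split.
- rewrite ReM; under eq_fun do rewrite ReM.
  by apply: cvgB; apply: cvgM.
- rewrite ImM; under eq_fun do rewrite ImM.
  by apply: cvgD; apply: cvgM.
Qed.

Lemma ulim_conj u a : ulim U u a -> ulim U (fun k => (u k)^*) (a^*).
Proof.
have Rec (x : F) : complex.Re (x^*) = complex.Re x by case: x.
have Imc (x : F) : complex.Im (x^*) = - complex.Im x by case: x.
move=> [ua ua']; split.
- by rewrite Rec; under eq_fun do rewrite Rec.
- by rewrite Imc; under eq_fun do rewrite Imc; apply: cvgN.
Qed.

Lemma ulim_norm2 u a : ulim U u a ->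
  ulim U (fun k => `|u k| ^+ 2) (`|a| ^+ 2).
Proof.
move=> ua; rewrite normCK; under eq_fun do rewrite normCK.
by apply: ulimM => //; apply: ulim_conj.
Qed.

Lemma ulim_sum (I : finType) (u : I -> nat -> F) (a : I -> F) :
  (forall i, ulim U (u i) (a i)) ->
  ulim U (fun k => \sum_i u i k) (\sum_i a i).
Proof.
move=> ua; elim: (index_enum I) => [|i s IH].
  by under eq_fun do rewrite big_nil; rewrite big_nil; apply: ulim_cst.
by under eq_fun do rewrite big_cons; rewrite big_cons; apply: ulimD.
Qed.

Lemma ulim_unique u a b : ulim U u a -> ulim U u b -> a = b.
Proof.
move=> [ua ua'] [ub ub']; apply/eqP; rewrite eq_complex; apply/andP; split.
- by apply/eqP; apply: cvg_unique ua ub; apply: norm_hausdorff.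
- by apply/eqP; apply: cvg_unique ua' ub'; apply: norm_hausdorff.
Qed.

Lemma ulim_exists u (K : F) : (forall k, `|u k| ^+ 2 <= K) ->
  exists a, ulim U u a.
Proof.
move=> uK; pose B := complex.Re K + 1.
have uB k : `|complex.Re (u k)| <= B /\ `|complex.Im (u k)| <= B.
  have := uK k; rewrite -add_Re2_Im2 lecE /= => /andP [_].
  have sq (t : R) : `|t| <= t ^+ 2 + 1.
    by rewrite -[t ^+ 2]real_normK ?num_real //; nra.
  move=> H; have := sqr_ge0 (complex.Re (u k)).
  have := sqr_ge0 (complex.Im (u k)); have := sq (complex.Re (u k)).
  by have := sq (complex.Im (u k)); rewrite /B => *; split; lra.
have [a aP] := ultra_bounded_cvg UF (fun k => (uB k).1).
have [b bP] := ultra_bounded_cvg UF (fun k => (uB k).2).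
by exists (Complex a b).
Qed.

Lemma ulim_harmonic : ulim U (fun k => (1 - k.+1%:R^-1 : R)%:C%C) 1.
Proof.
split=> /=; last exact: cvg_cst.
rewrite -[X in _ --> X]subr0; apply: cvgB; first exact: cvg_cst.
apply: (cvg_trans _ (@cvg_harmonic R)) => A; apply: UF.2.
Qed.

End Rules.
End UltraLimit.

(** * The decomposition *)

Section Passage.
Variables (F : numClosedFieldType) (n m : nat).
Implicit Types (z w r : F) (P : {poly {poly F}}).
Local Notation at_z z P := (map_poly (horner_eval z) P).

Lemma horner_at_z (p : {poly {poly F}}) z w :
  p.[z, w] = (at_z z (swapXY p)).[w].
Proof. by rewrite -[p in LHS]swapXYK horner_swapXY. Qed.

Lemma swapXY_reflect (p : {poly {poly F}}) :
  swapXY (reflect_poly n m p) = crev2 n m (swapXY p).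
Proof.
apply/polyP => j; apply/polyP => i; rewrite coef_swapXY !coef_poly.
case: (ltnP i n.+1) => [iN|iN]; last first.
  rewrite coef0; case: ifP => _; rewrite ?coef0 // nth_default //.
  exact: leq_trans (size_crev _ _) iN.
rewrite coef_poly; case: ifP => _; last by rewrite coef0.
by rewrite coef_poly iN coef_swapXY.
Qed.

Lemma bisize_swapXY (p : {poly {poly F}}) :
  has_bidegree p n m -> bisize_le n m (swapXY p).
Proof.
move=> [sp sYp]; split=> [|j]; first by rewrite -sizeYE sYp.
apply/leq_sizeP => i ni; rewrite coef_swapXY.
by rewrite [p`_i]nth_default ?coef0 // sp.
Qed.

Lemma at_w0_swapXY (p : {poly {poly F}}) : at_w0 p = (swapXY p)`_0.
Proof.
apply/polyP => i; rewrite coef_swapXY coef_map /= /horner_eval.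
by rewrite horner_coef0.
Qed.

Definition poly2 (a : 'I_n.+1 -> 'I_m.+1 -> F) : {poly {poly F}} :=
  \poly_(i < n.+1) \poly_(k < m.+1) a (inord i) (inord k).

Lemma horner_poly2 a z w : (poly2 a).[z, w] = ev2 a z w.
Proof.
rewrite horner_poly horner_sum; apply: eq_bigr => i _.
rewrite -rmorphXn hornerM hornerC horner_poly mulr_suml; apply: eq_bigr => k _.
by rewrite !inord_val mulrAC mulrA.
Qed.

Lemma coef_bound (P : {poly {poly F}}) : bisize_le n m P ->
  exists beta, forall j i, `|P`_j`_i| <= beta.
Proof.
move=> [sP sPj]; exists (\sum_(j < m.+1) \sum_(i < n.+1) `|P`_j`_i|) => j i.
have [mj|jm] := leqP m.+1 j.
  rewrite (nth_default _ (leq_trans sP mj)) coef0 normr0.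
  by apply: sumr_ge0 => k _; apply: sumr_ge0.
have [ni|iN] := leqP n.+1 i.
  rewrite (nth_default _ (leq_trans (sPj j) ni)) normr0.
  by apply: sumr_ge0 => k _; apply: sumr_ge0.
rewrite (bigD1 (Ordinal jm)) //= (bigD1 (Ordinal iN)) //= -addrA lerDl.
by apply: addr_ge0; apply: sumr_ge0 => k _ //; apply: sumr_ge0.
Qed.

(** The polynomial [P(z, r w)]. *)
Definition dilate (r : F) (P : {poly {poly F}}) : {poly {poly F}} :=
  \poly_(j < m.+1) (r ^+ j *: P`_j).

Lemma bisize_dilate r P : bisize_le n m P -> bisize_le n m (dilate r P).
Proof.
move=> [sP sPj]; split=> [|j]; first exact: size_poly.
rewrite coef_poly; case: ifP => _; last by rewrite size_poly0.
exact: leq_trans (size_scale_leq _ _) (sPj j).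
Qed.

Lemma horner_dilate r P z w : (size P <= m.+1)%N ->
  (at_z z (dilate r P)).[w] = \sum_(j < m.+1) r ^+ j * ((P`_j).[z] * w ^+ j).
Proof.
move=> sP; rewrite (@horner_coef_wide _ m.+1); last exact/size_at_z/size_poly.
apply: eq_bigr => j _; rewrite coef_at_z coef_poly ltn_ord hornerZ.
by rewrite mulrA.
Qed.

Lemma dilateE r P z w : (size P <= m.+1)%N ->
  (at_z z (dilate r P)).[w] = (at_z z P).[r * w].
Proof.
move=> sP; rewrite horner_dilate //.
rewrite (@horner_coef_wide _ m.+1); last exact/size_at_z.
by apply: eq_bigr => j _; rewrite coef_at_z exprMn mulrCA.
Qed.

Lemma horner_crev2_dilate r P z w :
  (at_z z (crev2 n m (dilate r P))).[w] =
  \sum_(j < m.+1) (r ^+ (m - j))^* * ((crev n P`_(m - j)).[z] * w ^+ j).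
Proof.
rewrite (@horner_coef_wide _ m.+1); last exact/size_at_z/size_poly.
apply: eq_bigr => j _; rewrite coef_at_z coef_poly ltn_ord mulrA.
congr (_ * _); rewrite coef_poly ltnS leq_subr -hornerZ; congr (_.[_]).
apply/polyP => i; rewrite coefZ !coef_poly.
case: ifP => _; last by rewrite mulr0.
by rewrite coefZ rmorphM.
Qed.

End Passage.

Section Limits.
Variables (R : realType) (n m : nat) (U : set_system nat).
Hypothesis UF : free_ultra U.
Local Notation F := R[i].
Local Notation at_z z P := (map_poly (horner_eval z) P).

Lemma ulimX (u : nat -> F) l j :
  ulim U u l -> ulim U (fun k => u k ^+ j) (l ^+ j).
Proof.
move=> ul; elim: j => [|j IH].
  by under eq_fun do rewrite expr0; rewrite expr0; apply: ulim_cst.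
by under eq_fun do rewrite exprS; rewrite exprS; apply: ulimM.
Qed.

Lemma ulim_ev2 (a : nat -> 'I_n.+1 -> 'I_m.+1 -> F) a0 z w :
  (forall i k, ulim U (fun t => a t i k) (a0 i k)) ->
  ulim U (fun t => ev2 (a t) z w) (ev2 a0 z w).
Proof.
move=> aa; apply: ulim_sum => // i; apply: ulim_sum => // k.
by apply: ulimM => //; apply: ulim_cst.
Qed.

Lemma ulim_sum_ev2 nu (a : nat -> 'I_nu -> 'I_n.+1 -> 'I_m.+1 -> F) a0 z w :
  (forall j i k, ulim U (fun t => a t j i k) (a0 j i k)) ->
  ulim U (fun t => \sum_j `|ev2 (a t j) z w| ^+ 2)
         (\sum_j `|ev2 (a0 j) z w| ^+ 2).
Proof.
move=> aa; apply: ulim_sum => // j; apply: ulim_norm2 => //.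
exact: ulim_ev2.
Qed.

Lemma ulim_coefs nu (a : nat -> 'I_nu -> 'I_n.+1 -> 'I_m.+1 -> F) (K : F) :
  (forall t j i k, `|a t j i k| ^+ 2 <= K) ->
  exists a0 : 'I_nu -> 'I_n.+1 -> 'I_m.+1 -> F,
    forall j i k, ulim U (fun t => a t j i k) (a0 j i k).
Proof.
move=> aK.
have [f fP] := choice (fun x : 'I_nu * 'I_n.+1 * 'I_m.+1 =>
  ulim_exists UF (fun t => aK t x.1.1 x.1.2 x.2)).
by exists (fun j i k => f (j, i, k)) => j i k; apply: (fP (j, i, k)).
Qed.

Lemma ulim_at_z_dilate (r : nat -> F) P z w : bisize_le n m P -> ulim U r 1 ->
  ulim U (fun t => (at_z z (dilate m (r t) P)).[w]) (at_z z P).[w].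
Proof.
move=> [sP _] r1; under eq_fun do rewrite horner_dilate //.
rewrite -[w in X in ulim _ _ X]mul1r -(@dilateE _ m) // horner_dilate //.
apply: ulim_sum => // j; apply: ulimM => //; first exact: ulimX.
exact: ulim_cst.
Qed.

Lemma ulim_crev2_dilate (r : nat -> F) P z w : bisize_le n m P -> ulim U r 1 ->
  ulim U (fun t => (at_z z (crev2 n m (dilate m (r t) P))).[w])
         (at_z z (crev2 n m P)).[w].
Proof.
move=> sP r1; have PE : P = dilate m 1 P.
  apply/polyP => j; rewrite coef_poly expr1n scale1r.
  by case: ltnP => // mj; rewrite nth_default // (leq_trans _ mj) // sP.1.
under eq_fun do rewrite horner_crev2_dilate.
rewrite [X in ulim _ _ (at_z z (crev2 n m X)).[w]]PE horner_crev2_dilate.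
apply: ulim_sum => // j; apply: ulimM => //; last exact: ulim_cst.
by apply: ulim_conj => //; apply: ulimX.
Qed.

End Limits.

Theorem theorem2p4 (R : realType) (n m n1 n2 : nat) (p : {poly {poly R[i]}})
    (hdeg : has_bidegree p n m)
    (hp : (forall z w : R[i], `|z| = 1 -> `|w| <= 1 -> p.[z, w] != 0)
       \/ ((forall z w : R[i], `|z| = 1 -> `|w| < 1 -> p.[z, w] != 0)
           /\ no_common_factor p (reflect_poly n m p)))
    (hn2 : n2 = nb_zeros_disk (at_w0 p))
    (hn1 : n1 = (n - n2)%N) :
  exists (A : 'I_m -> {poly {poly R[i]}})
         (B : 'I_n1 -> {poly {poly R[i]}})
         (C : 'I_n2 -> {poly {poly R[i]}}),
    forall z w : R[i],
      `|p.[z, w]| ^+ 2 - `|(reflect_poly n m p).[z, w]| ^+ 2 =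
        (1 - `|w| ^+ 2) * (\sum_(j < m) `|(A j).[z, w]| ^+ 2)
        + (1 - `|z| ^+ 2) * (\sum_(j < n1) `|(B j).[z, w]| ^+ 2
                             - \sum_(j < n2) `|(C j).[z, w]| ^+ 2).
Proof.
rewrite hn1 {hn1} hn2 {hn2} at_w0_swapXY.
set P := swapXY p; have sP : bisize_le n m P by apply: bisize_swapXY.
have P0 z w : `|z| = 1 -> `|w| < 1 -> (map_poly (horner_eval z) P).[w] != 0.
  move=> z1 w1; rewrite -horner_at_z; case: hp => [p0|[p0 _]]; apply: p0 => //.
  exact: ltW.
have [beta Pbeta] := coef_bound sP.
have [K KP] := strict_decomposition (@complex_archimedean R) n m beta.
pose r (t : nat) : R[i] := (1 - t.+1%:R^-1)%:C%C.
have r1 t : `|r t| < 1.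
  have t0 : 0 <= 1 - t.+1%:R^-1 :> R.
    by rewrite subr_ge0 invf_le1 ?ltr0n // ler1n.
  rewrite ger0_norm ?ler0c // /r -(rmorph1 (real_complex R)) ltcR.
  by rewrite ltrBlDr ltrDl invr_gt0 ltr0n.
have step t : exists abc : ('I_m -> 'I_n.+1 -> 'I_m.+1 -> R[i]) *
    ('I_(n - nb_zeros_disk P`_0) -> 'I_n.+1 -> 'I_m.+1 -> R[i]) *
    ('I_(nb_zeros_disk P`_0) -> 'I_n.+1 -> 'I_m.+1 -> R[i]),
  (forall z w,
    `|(map_poly (horner_eval z) (dilate m (r t) P)).[w]| ^+ 2 -
    `|(map_poly (horner_eval z) (crev2 n m (dilate m (r t) P))).[w]| ^+ 2 =
    (1 - `|w| ^+ 2) * (\sum_j `|ev2 (abc.1.1 j) z w| ^+ 2) +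
    (1 - `|z| ^+ 2) * (\sum_j `|ev2 (abc.1.2 j) z w| ^+ 2
                       - \sum_j `|ev2 (abc.2 j) z w| ^+ 2)) /\
  [/\ forall j i k, `|abc.1.1 j i k| ^+ 2 <= K,
      forall j i k, `|abc.1.2 j i k| ^+ 2 <= K
    & forall j i k, `|abc.2 j i k| ^+ 2 <= K].
  have := KP _ (bisize_dilate (r t) sP).
  have -> : (dilate m (r t) P)`_0 = P`_0 by rewrite coef_poly expr0 scale1r.
  case=> [j i|z w z1 w1|a [b [c abcP]]]; last by exists (a, b, c).
    rewrite coef_poly; case: ifP => _; last first.
      by rewrite coef0 normr0; apply: le_trans (Pbeta 0 0)%N.
    rewrite coefZ normrM normrX; apply: le_trans (Pbeta j i).
    by rewrite ler_piMl // exprn_ile1 // ltW.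
  rewrite dilateE ?sP.1 // P0 // normrM.
  by apply: le_lt_trans (r1 t); rewrite ler_piMr.
have [abc abcP] := choice step.
have [U UF] := free_ultra_exists.
have aK t j i k : `|(abc t).1.1 j i k| ^+ 2 <= K by case: (abcP t) => _ [].
have bK t j i k : `|(abc t).1.2 j i k| ^+ 2 <= K by case: (abcP t) => _ [].
have cK t j i k : `|(abc t).2 j i k| ^+ 2 <= K by case: (abcP t) => _ [].
have [a aP] := ulim_coefs UF aK.
have [b bP] := ulim_coefs UF bK.
have [c cP] := ulim_coefs UF cK.
have r_lim : ulim U r 1 by apply: ulim_harmonic.
exists (fun j => poly2 (a j)), (fun j => poly2 (b j)), (fun j => poly2 (c j)).
move=> z w; rewrite !horner_at_z swapXY_reflect -/P.
have poly2E nu (f : 'I_nu -> 'I_n.+1 -> 'I_m.+1 -> R[i]) :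
    \sum_j `|(poly2 (f j)).[z, w]| ^+ 2 = \sum_j `|ev2 (f j) z w| ^+ 2.
  by apply: eq_bigr => j _; rewrite horner_poly2.
rewrite !poly2E.
have sub_lim u v (x y : R[i]) : ulim U u x -> ulim U v y ->
    ulim U (fun t => u t - v t) (x - y).
  move=> ux vy; rewrite -mulN1r; under eq_fun do rewrite -mulN1r.
  by apply: ulimD => //; apply: ulimM => //; apply: ulim_cst.
apply: (ulim_unique UF).
  apply: (sub_lim); apply: ulim_norm2 => //.
    exact: ulim_at_z_dilate sP r_lim.
  exact: ulim_crev2_dilate sP r_lim.
under eq_fun do rewrite (abcP _).1.
apply: ulimD => //; apply: ulimM => //; try exact: ulim_cst.
  exact: ulim_sum_ev2.
by apply: sub_lim; apply: ulim_sum_ev2.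
Qed.
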